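(* Let $E$ be a complex Banach space and $\mathcal{A}$ a standard operator algebra on $E$. Fix a finite sequence $(i_1,\dots,i_m)$ with $\{i_1,\dots,i_m\}=\{1,\dots,k\}$, $k\ge 2$, such that some index $i_p$ occurs exactly once in the sequence, and consider the generalized product $T_1*\cdots*T_k=T_{i_1}\cdots T_{i_m}$ and the generalized Jordan product $T_1\circ\cdots\circ T_k=T_{i_1}\cdots T_{i_m}+T_{i_m}\cdots T_{i_1}$. Let $\phi:\mathcal{A}\to\mathcal{A}$ be a map (not assumed linear, additive or continuous). (i) Suppose the range of $\phi$ contains all operators on $E$ of rank at most two, and for any $a_1,\dots,a_k\in\mathcal{A}$ of which at least one has rank at most one there is an algebra automorphism $\theta_{a_1,\dots,a_k}$ of $\mathcal{A}$ with $\phi(a_1)*\cdots*\phi(a_k)=\theta_{a_1,\dots,a_k}(a_1*\cdots*a_k)$. (ii) Or suppose the range of $\phi$ contains all operators on $E$ of rank at most three, and for any $a_1,\dots,a_k\in\mathcal{A}$ of which at least one has rank at most one there is a linear Jordan automorphism $\theta_{a_1,\dots,a_k}$ of $\mathcal{A}$ with $\phi(a_1)\circ\cdots\circ\phi(a_k)=\theta_{a_1,\dots,a_k}(a_1\circ\cdots\circ a_k)$. In either case, there is a complex scalar $\xi$ with $\xi^m=1$ such that $\phi$ has either the form $A\mapsto \xi SAS^{-1}$ for an invertible bounded linear operator $S:E\to E$, or the form $A\mapsto \xi SA'S^{-1}$ for an invertible bounded linear operator $S:E'\to E$.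
   Context: $\mathcal{B}(E)$ is the algebra of bounded linear operators on $E$, $\mathcal{F}(E)$ its subalgebra of finite rank operators; a standard operator algebra on $E$ is a subalgebra of $\mathcal{B}(E)$ containing $\mathcal{F}(E)$. An algebra automorphism is a bijective linear multiplicative map. A linear Jordan automorphism is a bijective linear map $J$ with $J(ab+ba)=J(a)J(b)+J(b)J(a)$ for all $a,b$. $E'$ denotes the Banach dual of $E$ and $A':E'\to E'$ the dual (adjoint) operator of $A\in\mathcal{B}(E)$. *)

(* Defs.v *)
From mathcomp Require Import all_boot all_algebra.
From mathcomp Require Export complex.
From mathcomp Require Import all_classical all_reals all_analysis.
Import GRing.Theory Num.Theory.
Local Open Scope ring_scope.
Local Open Scope complex_scope.

Set Implicit Arguments.
Unset Strict Implicit.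
Unset Printing Implicit Defensive.

Section Ops.
Variables (R : realType) (E : normedModType R[i]).

Definition opadd (S T : E -> E) : E -> E := fun x => S x + T x.
Definition opscale (c : R[i]) (T : E -> E) : E -> E := fun x => c *: T x.

Definition is_linear_op (T : E -> E) : Prop :=
  forall (c : R[i]) (x y : E), T (c *: x + y) = c *: T x + T y.

Definition bounded_op (T : E -> E) : Prop :=
  is_linear_op T /\ exists M : R, forall x : E, `|T x| <= M%:C * `|x|.

Definition rank_le (T : E -> E) (n : nat) : Prop :=
  exists ys : 'I_n -> E, forall x : E,
    exists c : 'I_n -> R[i], T x = \sum_(i < n) c i *: ys i.

Definition finite_rank (T : E -> E) : Prop := exists n : nat, rank_le T n.

Definition standard_operator_algebra (A : set (E -> E)) : Prop :=
  [/\ (forall T, A T -> bounded_op T),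
      (forall T, bounded_op T -> finite_rank T -> A T),
      (forall S T, A S -> A T -> A (opadd S T)),
      (forall c S, A S -> A (opscale c S)) &
      (forall S T, A S -> A T -> A (S \o T))].

Definition linear_bijection_of (A : set (E -> E)) (th : (E -> E) -> (E -> E)) : Prop :=
  [/\ (forall a, A a -> A (th a)),
      (forall a b, A a -> A b -> th a = th b -> a = b),
      (forall b, A b -> exists2 a, A a & th a = b) &
      (forall c a b, A a -> A b -> th (opadd (opscale c a) b) = opadd (opscale c (th a)) (th b))].

Definition algebra_automorphism (A : set (E -> E)) (th : (E -> E) -> (E -> E)) : Prop :=
  linear_bijection_of A th /\
  (forall a b, A a -> A b -> th (a \o b) = th a \o th b).

Definition jordan_automorphism (A : set (E -> E)) (th : (E -> E) -> (E -> E)) : Prop :=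
  linear_bijection_of A th /\
  (forall a b, A a -> A b ->
     th (opadd (a \o b) (b \o a)) = opadd (th a \o th b) (th b \o th a)).

Definition gen_prod (k : nat) (idx : seq 'I_k) (T : 'I_k -> E -> E) : E -> E :=
  foldr (fun i acc => T i \o acc) id idx.

Definition gen_jordan (k : nat) (idx : seq 'I_k) (T : 'I_k -> E -> E) : E -> E :=
  opadd (gen_prod idx T) (gen_prod (rev idx) T).

Definition dual_elem (f : E -> R[i]) : Prop :=
  (forall (c : R[i]) (x y : E), f (c *: x + y) = c * f x + f y) /\
  exists M : R, forall x : E, `|f x| <= M%:C * `|x|.

(* S : E' -> E invertible bounded linear operator, with inverse Sinv : E -> E'.
   Boundedness is ||S f|| <= M ||f||, ||Sinv x|| <= M ||x||, with the operator
   norm of a functional unfolded. *)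
Definition invertible_dual_op (S : (E -> R[i]) -> E) (Sinv : E -> (E -> R[i])) : Prop :=
  [/\ (forall x, dual_elem (Sinv x)),
      (forall f, dual_elem f -> Sinv (S f) = f) /\ (forall x, S (Sinv x) = x),
      (forall (c : R[i]) f g, dual_elem f -> dual_elem g ->
          S (fun y => c * f y + g y) = c *: S f + S g),
      (exists M : R, forall f (c : R), dual_elem f -> 0 <= c ->
          (forall y, `|f y| <= c%:C * `|y|) -> `|S f| <= (M * c)%:C) &
      (exists M : R, forall x y, `|Sinv x y| <= M%:C * `|x| * `|y|)].

Definition invertible_op (S Sinv : E -> E) : Prop :=
  [/\ bounded_op S, bounded_op Sinv, cancel S Sinv & cancel Sinv S].

End Ops.

(* Main.v *)
(** Put a at the index occurring once and b at all others: the hypothesis becomes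
    phi(b)^r phi(a) phi(b)^s = theta(b^r a b^s) with r + s = m - 1, or its symmetrized
    version, whenever a or b has rank at most one.  Every theta is a Jordan automorphism,
    so it preserves rank-one operators and their traces.  Testing against phi(b) diagonal
    of rank two (or three, in the Jordan case with r <> s) shows that the 2x2 (3x3) minors of
    the resulting matrices vanish, and together with rank phi(a)^m <= 1 this forces phi to map
    rank-one operators to rank-one operators.  Taking traces,
    tr(phi(a) phi(b)^(m-1)) = tr(a b^(m-1)) if a or b has rank one.  Hence phi is
    bilinear on the x (x) f, and so x (x) f |-> Sx (x) Tf or x (x) f |-> Tf (x) Sx; the trace
    identity then determines phi on the whole algebra, makes S and T bijective, and shows
    that they are weakly bounded, hence bounded by the uniform boundedness principle. *)

(* Nothing relates the automorphisms attached to different tuples, so only what every Jordan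
   automorphism preserves can be compared: rank at most one and the trace. Linearity on rank-one
   operators comes from the size of the range: if phi(b) = v (x) k with k v = 1, then phi(b) is
   idempotent, and with n = m - 1 the number tr(phi(a) phi(b)^n) = k(phi(a) v) equals tr(a b^n),
   which is linear in a. For r <> s the Jordan word b^r a b^s + b^s a b^r of a rank-one a may have
   rank two, so only 3x3 minors vanish; the eigenvalues of phi(b) are then varied to extract more
   than one relation from them. For r = s the Jordan word is twice an ordinary word. The scalar xi
   is the trace of the image of a rank-one idempotent. The two forms of phi correspond to which
   factor of phi(x (x) f) depends on x; a mixture of the two forces E to be a line, where both
   coincide. *)
Require Import Defs.
From HB Require Import structures.
From mathcomp Require Import all_boot all_order all_algebra.
From mathcomp Require Import complex.
From mathcomp Require Import all_classical all_reals all_analysis.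
From mathcomp Require Import ring lra.
Import Order.TTheory GRing.Theory Num.Theory.
Import numFieldNormedType.Exports.
Local Open Scope classical_set_scope.
Local Open Scope ring_scope.
Local Open Scope complex_scope.

Set Implicit Arguments.
Unset Strict Implicit.
Unset Printing Implicit Defensive.

(** * Complex Hahn-Banach *)

Section Sublinear.
Variables (R : realType) (V : lmodType R[i]).
Implicit Types (p q : V -> R) (x y : V).

Definition sublinear p :=
  (forall x y, p (x + y) <= p x + p y) /\
  (forall (r : R) x, 0 < r -> p (r%:C *: x) <= r * p x).

Lemma sublinear0 p : sublinear p -> p 0 = 0.
Proof.
move=> [_ pZ]; have := pZ 2 0 ltac:(lra); have := pZ 2^-1 0 ltac:(lra).
by rewrite !scaler0; lra.
Qed.

Lemma sublinearZ p r x : sublinear p -> 0 < r -> p (r%:C *: x) = r * p x.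
Proof.
move=> [_ pZ] r0; apply/eqP; rewrite eq_le pZ //=.
have ri0 : 0 < r^-1 by rewrite invr_gt0.
have := pZ r^-1 (r%:C *: x) ri0.
rewrite scalerA -rmorphM /= mulVf ?lt0r_neq0// scale1r.
by rewrite ler_pdivlMl.
Qed.

Lemma sublinearN p x : sublinear p -> - p (- x) <= p x.
Proof.
by move=> sp; have := sp.1 x (- x); rewrite subrr sublinear0//; lra.
Qed.

(* [shift p y] is a sublinear minorant of p whose value at - y is at most - p y, so a
   minimal sublinear functional is linear. *)
Definition shift p y x : R :=
  inf [set p (x + t%:C *: y) - t * p y | t in [set t : R | 0 < t]].

Lemma shift_lb p y x : sublinear p ->
  lbound [set p (x + t%:C *: y) - t * p y | t in [set t : R | 0 < t]] (- p (- x)).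
Proof.
move=> sp _ [t /= t0 <-]; have := sp.1 (x + t%:C *: y) (- x).
by rewrite addrAC subrr add0r sublinearZ//; lra.
Qed.

Lemma shift_le p y x t : sublinear p -> 0 < t ->
  shift p y x <= p (x + t%:C *: y) - t * p y.
Proof.
move=> sp t0; apply: ge_inf; last by exists t.
by exists (- p (- x)); exact: shift_lb.
Qed.

Lemma le_shift p y x c : (forall t, 0 < t -> c <= p (x + t%:C *: y) - t * p y) ->
  c <= shift p y x.
Proof.
move=> H; apply: lb_le_inf; first by eexists; exists 1 => //=.
by move=> _ [t /= t0 <-]; exact: H.
Qed.

Lemma shift_sublinear p y : sublinear p -> sublinear (shift p y).
Proof.
move=> sp; split=> [x z|r x r0].
  rewrite -lerBlDr; apply: le_shift => t t0.
  rewrite lerBlDr -lerBlDl; apply: le_shift => s s0; rewrite lerBlDl.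
  apply: le_trans (shift_le y (x + z) sp (addr_gt0 t0 s0)) _.
  have := sp.1 (x + t%:C *: y) (z + s%:C *: y).
  by rewrite rmorphD /= scalerDl addrACA; lra.
rewrite -ler_pdivrMl//; apply: le_shift => t t0; rewrite ler_pdivrMl//.
apply: le_trans (shift_le y (r%:C *: x) sp (mulr_gt0 r0 t0)) _.
rewrite rmorphM /= -scalerA -scalerDr sublinearZ//; lra.
Qed.

Lemma shift_le_id p y x : sublinear p -> shift p y x <= p x.
Proof.
move=> sp; apply: le_trans (shift_le y x sp ltr01) _.
by have := sp.1 x y; rewrite scale1r; lra.
Qed.

(** Zorn's lemma for the reversed pointwise order. The infimum of a chain is finite because every
    member a satisfies a x >= - a (- x) >= - p (- x), and it is subadditive because any two members
    are comparable. *)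
Lemma minimal_sublinear p : sublinear p -> exists q,
  [/\ sublinear q, (forall x, q x <= p x) &
      forall q', sublinear q' -> (forall x, q' x <= q x) -> q' = q].
Proof.
move=> sp.
pose P q := sublinear q /\ (forall x, q x <= p x).
pose T := {q : V -> R | P q}.
pose r (a b : T) := `[< forall x, sval b x <= sval a x >].
have [||||[q [sq qp]] qmin] := @Zorn T r.
- by move=> t; apply/asboolP.
- move=> a b c /asboolP ab /asboolP bc; apply/asboolP => x.
  exact: le_trans (bc x) (ab x).
- move=> [a Pa] [b Pb] /asboolP /= ab /asboolP /= ba.
  apply: eq_exist; apply/funext => x; apply/eqP.
  by rewrite eq_le ab ba.
- move=> F totF; have [[a0 Fa0]|F0] := pselect (exists a, F a); last first.
    exists (exist P p (conj sp (fun x => lexx _))) => s Fs.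
    by exfalso; apply: F0; exists s.
  pose S x := [set sval a x | a in F].
  have Slb x : lbound (S x) (- p (- x)).
    move=> _ [[a [sa pa]] /= Fa <-]; apply: le_trans (sublinearN x sa).
    by rewrite lerN2.
  have leS x a : F a -> inf (S x) <= sval a x.
    by move=> Fa; apply: ge_inf; [exists (- p (- x))|exists a].
  have Sle x c : (forall a, F a -> c <= sval a x) -> c <= inf (S x).
    move=> H; apply: lb_le_inf; first by eexists; exists a0.
    by move=> _ [a Fa <-]; exact: H.
  have sS : sublinear (fun x => inf (S x)).
    split=> [x y|t x t0].
      rewrite -lerBlDr; apply/Sle => a Fa.
      rewrite lerBlDr -lerBlDl; apply/Sle => b Fb; rewrite lerBlDl.
      have [/asboolP ab|/asboolP ba] := totF _ _ Fa Fb.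
        apply: le_trans (leS _ b Fb) _; apply: le_trans ((svalP b).1.1 x y) _.
        by rewrite lerD2r.
      apply: le_trans (leS _ a Fa) _; apply: le_trans ((svalP a).1.1 x y) _.
      by rewrite lerD2l.
    rewrite -ler_pdivrMl//; apply/Sle => a Fa; rewrite ler_pdivrMl//.
    apply: le_trans (leS _ a Fa) _; exact: (svalP a).1.2.
  have Sp x : inf (S x) <= p x.
    by apply: le_trans (leS _ _ Fa0) _; exact: (svalP a0).2.
  exists (exist P _ (conj sS Sp)) => s Fs; apply/asboolP => x /=; exact: leS.
exists q; split=> // q' sq' q'q.
have q'p x : q' x <= p x := le_trans (q'q x) (qp x).
by have /(_ _)/(congr1 sval) := qmin (exist P q' (conj sq' q'p)); apply; apply/asboolP.
Qed.

Lemma minimal_sublinear_linear q : sublinear q ->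
  (forall q', sublinear q' -> (forall x, q' x <= q x) -> q' = q) ->
  (forall x y, q (x + y) = q x + q y) /\
  (forall (r : R) x, q (r%:C *: x) = r * q x).
Proof.
move=> sq qmin.
have qD x y : q (x + y) = q x + q y.
  apply/eqP; rewrite eq_le sq.1 /=.
  have sqE : shift q y = q.
    by apply: qmin; [exact: shift_sublinear|move=> z; exact: shift_le_id].
  have := shift_le y x sq ltr01.
  by rewrite sqE scale1r mul1r lerBrDr.
have qN x : q (- x) = - q x.
  by apply/eqP; rewrite eq_sym -subr_eq0 -opprD oppr_eq0 -qD subrr sublinear0.
split=> // r x; case: (ltgtP r 0) => r0; last 2 first.
- by rewrite sublinearZ.
- by rewrite r0 scale0r sublinear0// mul0r.
by rewrite -[r]opprK rmorphN scaleNr qN sublinearZ ?oppr_gt0// !mulNr.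
Qed.

End Sublinear.

Section RealNorm.
Variable R : realType.

(* Norms over R[i] are R[i]-valued; [nr] is the same norm with values in R. *)
Definition nr (V : normedZmodType R[i]) (x : V) : R := complex.Re `|x|.

Lemma nrE (V : normedZmodType R[i]) (x : V) : `|x| = (nr x)%:C.
Proof. by rewrite /nr RRe_real// ger0_real. Qed.

Lemma nr_ge0 (V : normedZmodType R[i]) (x : V) : 0 <= nr x.
Proof. by rewrite -ler0c -nrE normr_ge0. Qed.

Lemma nrD (V : normedZmodType R[i]) (x y : V) : nr (x + y) <= nr x + nr y.
Proof. by rewrite -lecR rmorphD /= -!nrE ler_normD. Qed.

Lemma nrN (V : normedZmodType R[i]) (x : V) : nr (- x) = nr x.
Proof. by rewrite /nr normrN. Qed.

Lemma nr_eq0 (V : normedZmodType R[i]) (x : V) : (nr x == 0) = (x == 0).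
Proof. by rewrite -[x == 0]normr_eq0 nrE; apply/eqP/eqP => [->|/complexI]. Qed.

Lemma nr0 (V : normedZmodType R[i]) : nr (0 : V) = 0.
Proof. by apply/eqP; rewrite nr_eq0. Qed.

Lemma nrM (c d : R[i]) : nr (c * d) = nr c * nr d.
Proof. by apply: complexI; rewrite rmorphM /= -!nrE normrM. Qed.

Lemma nrZ (V : normedModType R[i]) (c : R[i]) (x : V) : nr (c *: x) = nr c * nr x.
Proof. by apply: complexI; rewrite rmorphM /= -!nrE normrZ. Qed.

Lemma nr_real (r : R) : 0 <= r -> nr r%:C = r.
Proof. by move=> r0; apply: complexI; rewrite -nrE ger0_norm// ler0c. Qed.

End RealNorm.

Section HahnBanach.
Variables (R : realType) (E : normedModType R[i]).

Lemma nr_sublinear : sublinear (@nr R E).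
Proof. by split=> [x y|r x r0]; rewrite ?nrD// nrZ nr_real// ltW. Qed.

(** A minimal functional g below [shift nr x0] has g (- x0) <= - nr x0, hence attains the norm at
    x0. It is complexified as g x - i g (i x). At x0 the modulus is at most the real part, so the
    imaginary part vanishes. *)
Lemma norming_functional (x0 : E) : exists f : E -> R[i],
  [/\ forall (c : R[i]) (x y : E), f (c *: x + y) = c * f x + f y,
      forall x, nr (f x) <= nr x & f x0 = (nr x0)%:C].
Proof.
have sN := nr_sublinear.
have [g [sg gp gmin]] := minimal_sublinear (shift_sublinear x0 sN).
have [gD gZ] := minimal_sublinear_linear sg gmin.
have gN x : g x <= nr x by apply: le_trans (gp x) (shift_le_id _ _ sN).
have gx0 : g x0 = nr x0.
  apply/eqP; rewrite eq_le gN /=.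
  have := le_trans (gp (- x0)) (shift_le x0 (- x0) sN ltr01).
  rewrite scale1r addNr nr0 mul1r sub0r.
  by rewrite -[- x0]scaleN1r -(rmorphN1 (real_complex R)) gZ; lra.
pose f x := (g x)%:C - 'i%C * (g ('i%C *: x))%:C.
have fD x y : f (x + y) = f x + f y.
  by rewrite /f scalerDr !gD !rmorphD /=; ring.
have fR (r : R) x : f (r%:C *: x) = r%:C * f x.
  have -> : f (r%:C *: x) = (g (r%:C *: x))%:C - 'i%C * (g (r%:C *: ('i%C *: x)))%:C.
    by rewrite /f !scalerA [r%:C * _]mulrC.
  by rewrite !gZ !rmorphM /= /f; ring.
have fi x : f ('i%C *: x) = 'i%C * f x.
  rewrite /f scalerA -expr2 sqr_i -(rmorphN1 (real_complex R)) gZ mulN1r rmorphN /=.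
  by rewrite mulrBr mulrA -expr2 sqr_i; ring.
have fZ c x : f (c *: x) = c * f x.
  by rewrite [c]complexE scalerDl fD -scalerA fi !fR; ring.
have fle x : nr (f x) <= nr x.
  have [fx0|fx0] := eqVneq (f x) 0; first by rewrite fx0 nr0 nr_ge0.
  (* The unimodular w rotates f x onto the positive axis, where f and its real part g agree. *)
  pose w := `|f x| / f x.
  have nw : nr w = 1.
    by apply: complexI; rewrite -nrE normf_div normr_id divff// normr_eq0.
  have fwx : f (w *: x) = (nr (f x))%:C by rewrite fZ divfK// nrE.
  have : (g (w *: x)) = nr (f x).
    have := congr1 (@complex.Re R) fwx; rewrite /f /= => <-; ring.
  move=> <-; apply: le_trans (gN _) _; by rewrite nrZ nw mul1r.
exists f; split=> //; first by move=> c x y; rewrite fD fZ.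
have : complex.Re (f x0) = nr x0 by rewrite /f /= -gx0; ring.
have := fle x0.
case: (f x0) => a b /=; rewrite /nr normc_def /= => + ab.
rewrite ab => le.
have b0 : b = 0.
  apply/eqP; rewrite -sqrf_eq0 eq_le sqr_ge0 andbT.
  have n0 := nr_ge0 x0.
  have := ler_sqr (x := Num.sqrt (nr x0 ^+ 2 + b ^+ 2)) (y := nr x0).
  rewrite !nnegrE sqrtr_ge0 n0 => /(_ isT isT); rewrite le => /esym.
  rewrite sqr_sqrtr ?addr_ge0 ?sqr_ge0//; lra.
by rewrite b0.
Qed.

End HahnBanach.

(** * Uniform boundedness *)

Section UniformBoundedness.
Variable R : realType.

(** The rate is the tail of the geometric series, 4^-n + 4^-(n+1) + ... = 4/3 * 4^-n. Stating
    completeness for a bare function N lets the same theorem serve E with [nr] and its dual with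
    [opnorm]. *)
Definition geometric_complete (V : lmodType R[i]) (N : V -> R) :=
  forall u : nat -> V, (forall n, N (u n.+1 - u n) <= 4^-1 ^+ n) ->
  exists x, forall n, N (u n - x) <= 4 / 3 * 4^-1 ^+ n.

(* Sokal's proof of the uniform boundedness principle: for a seminorm g, one of
   g (v + d) and g (v - d) is at least g d, so that a geometric series of
   perturbations makes infinitely many members of the family large at its limit. *)
Theorem uniform_boundedness (V : lmodType R[i]) (N : V -> R) (I : Type)
    (g : I -> V -> R) :
  (forall x, 0 <= N x) ->
  (forall x, N (- x) = N x) ->
  (forall (r : R) x, 0 < r -> N (r%:C *: x) = r * N x) ->
  geometric_complete N ->
  (forall i x y, g i (x + y) <= g i x + g i y) ->
  (forall i x, g i (- x) = g i x) ->
  (forall i (r : R) x, 0 < r -> g i (r%:C *: x) = r * g i x) ->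
  (forall i, exists C, forall x, g i x <= C * N x) ->
  (forall x, exists M, forall i, g i x <= M) ->
  exists M, forall i x, g i x <= M * N x.
Proof.
move=> N0 NN NZ Ncomp gD gN gZ gC gM; apply: contrapT => unb.
have unbE M : exists i x, M * N x < g i x.
  apply: contrapT => H; apply: unb; exists M => i x.
  by rewrite leNgt; apply/negP => lt; apply: H; exists i, x.
(* G is the seminorm of g i. All later perturbations together move the limit by at most 4/3 *
   4^-(n+1) = 4^-n / 3, so g i at the limit keeps at least (1/2 - 1/3) 4^-n G = 4^-n G / 6, which is
   at least n. *)
have step n v : exists v', N (v' - v) <= 4^-1 ^+ n /\ exists i G,
    [/\ forall y, g i y <= G * N y, 2^-1 * 4^-1 ^+ n * G <= g i v' &
        n%:R <= 6^-1 * 4^-1 ^+ n * G].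
  have p4 : 0 < 4^-1 ^+ n :> R by rewrite exprn_gt0//; lra.
  pose M := 6 * (4^-1 ^+ n)^-1 * n%:R : R.
  have M0 : 0 <= M by rewrite !mulr_ge0// ?invr_ge0 ?ltW.
  have [i [x Mx]] := unbE M.
  have [C gCi] := gC i.
  have gpos y : 0 <= g i y.
    have := gD i y (- y); rewrite subrr gN.
    have := gZ i 2 0 ltac:(lra); rewrite scaler0; lra.
  pose S := [set g i y | y in [set y | N y <= 1]].
  have supS : has_sup S.
    split.
      exists (g i 0); exists 0 => //=.
      have := NZ 2 0 ltac:(lra); rewrite scaler0; lra.
    exists `|C| => _ [y /= y1 <-]; apply: le_trans (gCi y) _.
    apply: le_trans (ler_wpM2r (N0 y) (ler_norm C)) _.
    by rewrite ler_piMr.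
  pose G := sup S.
  have gG y : g i y <= G * N y.
    have [Ny|Ny] := eqVneq (N y) 0.
      by rewrite Ny mulr0; have := gCi y; rewrite Ny mulr0.
    have Nyp : 0 < N y by rewrite lt_def Ny N0.
    have Niy : 0 < (N y)^-1 by rewrite invr_gt0.
    rewrite -ler_pdivrMr// mulrC -gZ//; apply: ub_le_sup; first exact: supS.2.
    by exists ((N y)^-1%:C *: y) => //=; rewrite NZ// mulVf.
  have GM : M < G.
    have Nx : 0 < N x.
      rewrite lt_def N0 andbT; apply/eqP => Nx; move: Mx.
      by have := gCi x; rewrite Nx !mulr0; lra.
    by rewrite -(ltr_pM2r Nx); apply: lt_le_trans Mx _; exact: gG.
  have G0 : 0 < G / 2 by rewrite divr_gt0//; exact: le_lt_trans M0 GM.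
  have [_ [d0 /= d01 <-] Gd] := sup_adherent G0 supS.
  pose d := (4^-1 ^+ n)%:C *: d0.
  have Nd : N d <= 4^-1 ^+ n by rewrite NZ// ler_piMr// ltW.
  have gd : 2^-1 * 4^-1 ^+ n * G <= g i d.
    have : 4^-1 ^+ n * (G - G / 2) <= g i d by rewrite gZ// ler_wpM2l// ltW.
    by lra.
  have gdd : 2 * g i d <= g i (v + d) + g i (v - d).
    rewrite -gZ; last by lra.
    have -> : 2%:C *: d = (v + d) + (- (v - d)).
      by rewrite opprB addrC addrA subrK -mulr2n rmorphMn /= scaler_nat.
    by apply: le_trans (gD _ _ _) _; rewrite gN.
  have Gn : n%:R <= 6^-1 * 4^-1 ^+ n * G.
    have -> : n%:R = 6^-1 * 4^-1 ^+ n * M.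
      rewrite /M; field; exact: lt0r_neq0.
    by rewrite ler_wpM2l ?ltW// mulr_gt0//; lra.
  have [le|le] := leP (g i d) (g i (v + d)).
    exists (v + d); split; first by rewrite addrC addKr.
    by exists i, G; split=> //; exact: le_trans gd le.
  exists (v - d); split; first by rewrite addrAC subrr sub0r NN.
  by exists i, G; split=> //; lra.
pose next n v := projT1 (cid (step n v)).
have nextP n v := projT2 (cid (step n v)); rewrite -/(next _ _) in nextP.
pose u := fix u n := if n is n'.+1 then next n' (u n') else 0.
have [x xu] := Ncomp u (fun n => (nextP n (u n)).1).
have [M gMx] := gM x.
have [n Mn] : exists n, M < n%:R.
  by exists (Num.truncn M).+1; exact: truncnS_gt.
have [_ [i [G [gG Gu Gn]]]] := nextP n (u n).
have G0 : 0 <= G.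
  rewrite -(@pmulr_rge0 _ (6^-1 * 4^-1 ^+ n)); last first.
    by rewrite mulr_gt0 ?exprn_gt0//; lra.
  exact: le_trans (ler0n _ n) Gn.
have := gMx i; apply/negP; rewrite -ltNge; apply: lt_le_trans Mn _.
apply: le_trans Gn _.
have := gD i x (u n.+1 - x); rewrite addrC subrK.
have := gG (u n.+1 - x).
have := ler_wpM2l G0 (xu n.+1); rewrite exprS /= in Gu *; lra.
Qed.

End UniformBoundedness.

Section GeometricCompleteness.
Variables (R : realType) (E : completeNormedModType R[i]).

Lemma geometric_cvg (u : nat -> E) (C : R) : 0 <= C ->
  (forall n, nr (u n.+1 - u n) <= C * 4^-1 ^+ n) ->
  exists x, forall n, nr (u n - x) <= C * (4 / 3 * 4^-1 ^+ n).
Proof.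
move=> C0 uC.
have tail n k : nr (u (n + k)%N - u n) <=
    C * (4 / 3 * (4^-1 ^+ n - 4^-1 ^+ (n + k))).
  elim: k => [|k IH]; first by rewrite addn0 !subrr nr0 !mulr0.
  have -> : u (n + k.+1)%N - u n = (u (n + k).+1 - u (n + k)%N) + (u (n + k)%N - u n).
    by rewrite addnS addrA subrK.
  apply: le_trans (nrD _ _) _; apply: le_trans (lerD (uC _) IH) _.
  by rewrite addnS [in leRHS]exprS; lra.
have p4 n : 0 < 4^-1 ^+ n :> R by rewrite exprn_gt0//; lra.
have tail2 n k : nr (u (n + k)%N - u n) <= C * (4 / 3 * 4^-1 ^+ n).
  by apply: le_trans (tail n k) _; rewrite ler_wpM2l//; have := p4 (n + k)%N; lra.
have small (e : R) : 0 < e -> exists n, C * (4 / 3 * 4^-1 ^+ n) < e.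
  move=> e0.
  have lim0 : (fun n => C * (4 / 3 * 4^-1 ^+ n) : R) @ \oo --> C * (4 / 3 * 0).
    apply: cvgM; first exact: cvg_cst.
    apply: cvgM; first exact: cvg_cst.
    by apply: cvg_expr; rewrite ger0_norm; lra.
  rewrite !mulr0 in lim0.
  have /cvgrPdist_lt /(_ e e0) [n _ /(_ n (leqnn n))] := lim0.
  rewrite /= sub0r normrN ger0_norm; first by exists n.
  by rewrite !mulr_ge0// ?ltW//; lra.
have cu : cvg (u @ \oo).
  apply/cauchy_cvgP/cauchy_exP => e e0.
  have eR : 0 < complex.Re e by move: e0; rewrite ltcE => /andP[].
  have eE : e = (complex.Re e)%:C by rewrite RRe_real// gtr0_real.
  have [n ne] := small _ eR.
  exists (u n), n => //= k /= nk; rewrite -ball_normE /ball_/=.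
  rewrite nrE eE ltcR -opprB nrN -(subnKC nk).
  exact: le_lt_trans (tail2 _ _) ne.
exists (limn u) => n.
apply/ler_addgt0Pr => e e0.
have eC : 0 < e%:C by rewrite ltcR.
have /cvgrPdist_lt /(_ _ eC)[k _ /(_ (n + k)%N (leq_addl _ _))] /= := cu.
rewrite nrE ltcR => H.
have -> : u n - limn u = - (u (n + k)%N - u n) - (limn u - u (n + k)%N).
  by rewrite !opprB addrA addrNK.
apply: le_trans (nrD _ _) _; rewrite !nrN; apply: lerD (ltW H).
exact: tail2.
Qed.

Lemma nr_geometric_complete : geometric_complete (@nr R E).
Proof.
move=> u uC; have [|x xu] := @geometric_cvg u 1 ler01.
  by move=> n; rewrite mul1r.
by exists x => n; rewrite -[leRHS]mul1r.
Qed.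

End GeometricCompleteness.

(** * The dual space *)

Section Dual.
Variables (R : realType) (E : normedModType R[i]).

Definition dual_pred : {pred E -> R[i]} := fun f => `[< dual_elem f >].

Lemma dual_elemP (f : E -> R[i]) : dual_elem f <->
  (forall (c : R[i]) (x y : E), f (c *: x + y) = c * f x + f y) /\
  exists2 M : R, 0 <= M & forall x, nr (f x) <= M * nr x.
Proof.
split=> [[lf [M fM]]|[lf [M M0 fM]]]; split=> //.
  exists `|M| => // x; rewrite -lecR rmorphM /= -!nrE.
  apply: le_trans (fM x) _; rewrite ler_wpM2r// lecR; exact: ler_norm.
by exists M => x; rewrite !nrE -rmorphM /= lecR.
Qed.

Lemma dual_submod_closed : submod_closed dual_pred.
Proof.
split=> [|c f g /asboolP /dual_elemP[lf [M M0 fM]] /asboolP /dual_elemP[lg [K K0 gK]]].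
  apply/asboolP/dual_elemP; split=> [c x y|]; first by rewrite /= mulr0 addr0.
  by exists 0 => // x; rewrite mul0r nr0.
apply/asboolP/dual_elemP; split=> [a x y|].
  have -> : (c *: f + g) (a *: x + y) = c * f (a *: x + y) + g (a *: x + y) by [].
  have -> : (c *: f + g) x = c * f x + g x by [].
  have -> : (c *: f + g) y = c * f y + g y by [].
  by rewrite lf lg; ring.
exists (nr c * M + K); first by rewrite addr_ge0// mulr_ge0// nr_ge0.
move=> x; have -> : (c *: f + g) x = c * f x + g x by [].
apply: le_trans (nrD _ _) _; rewrite nrM mulrDl -mulrA.
by rewrite lerD// ler_wpM2l// nr_ge0.
Qed.

HB.instance Definition _ :=
  GRing.isSubmodClosed.Build R[i] (E -> R[i]) dual_pred dual_submod_closed.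

(** Bundled so that bounded functionals form an [lmodType]: the two factors of x (x) f can then
    exchange roles. *)
Record dual := Dual { dual_val :> E -> R[i]; dual_valP : dual_val \in dual_pred }.

HB.instance Definition _ := [isSub for dual_val].
HB.instance Definition _ := [Choice of dual by <:].
HB.instance Definition _ := [SubChoice_isSubLmodule of dual by <:].

Lemma dual_valE (f : dual) : dual_elem f.
Proof. exact/asboolP/dual_valP. Qed.

Definition to_dual (f : E -> R[i]) (hf : dual_elem f) : dual := Dual (asboolT hf).

Lemma dual_linear (f : dual) : scalar f.
Proof. by case: (dual_valE f). Qed.

HB.instance Definition _ (f : dual) :=
  GRing.isLinear.Build R[i] E R[i] *%R f (dual_linear f).

Lemma dual_D (f : dual) x y : f (x + y) = f x + f y. Proof. exact: linearD. Qed.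
Lemma dual_B (f : dual) x y : f (x - y) = f x - f y. Proof. exact: linearB. Qed.
Lemma dual_Z (f : dual) c x : f (c *: x) = c * f x. Proof. exact: linearZ. Qed.
Lemma dual_0 (f : dual) : f 0 = 0. Proof. exact: linear0. Qed.

Lemma dualE_D (f g : dual) x : (f + g) x = f x + g x. Proof. by []. Qed.
Lemma dualE_Z c (f : dual) x : (c *: f) x = c * f x. Proof. by []. Qed.
Lemma dualE_N (f : dual) x : (- f) x = - f x. Proof. by []. Qed.
Lemma dualE_B (f g : dual) x : (f - g) x = f x - g x. Proof. by []. Qed.
Lemma dualE_0 x : (0 : dual) x = 0. Proof. by []. Qed.

Lemma dual_eq (f g : dual) : f =1 g -> f = g.
Proof. by move=> fg; apply/val_inj/funext. Qed.

Lemma dual_sep (x : E) : x != 0 -> exists f : dual, f x = 1.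
Proof.
move=> x0; have [f [lf fle fx]] := norming_functional x.
have hf : dual_elem f.
  by apply/dual_elemP; split=> //; exists 1 => // y; rewrite mul1r.
have nx : f x != 0 by rewrite fx -nrE normr_eq0.
by exists ((f x)^-1 *: to_dual hf); rewrite dualE_Z /= mulVf.
Qed.

Lemma dual_eq0 (x : E) : (forall f : dual, f x = 0) -> x = 0.
Proof.
move=> fx0; apply/eqP/negPn/negP => /dual_sep[f fx].
by have := fx0 f; rewrite fx => /eqP; rewrite oner_eq0.
Qed.

Lemma dual_inj (x y : E) : (forall f : dual, f x = f y) -> x = y.
Proof. by move=> fxy; apply/subr0_eq/dual_eq0 => f; rewrite linearB /= fxy subrr. Qed.

Lemma dual_neq0 (f : dual) : f != 0 -> exists x, f x = 1.
Proof.
move=> f0; have [x fx] : exists x, f x != 0.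
  apply: contrapT => H; move/eqP: f0; apply; apply: dual_eq => x.
  by apply/eqP/negPn/negP => fx; apply: H; exists x.
by exists ((f x)^-1 *: x); rewrite linearZ /= mulVf.
Qed.

Definition opnorm (f : dual) : R :=
  inf [set M | 0 <= M /\ forall x, nr (f x) <= M * nr x].

Lemma opnorm_le (f : dual) M : 0 <= M -> (forall x, nr (f x) <= M * nr x) ->
  opnorm f <= M.
Proof. by move=> M0 fM; apply: ge_inf => //; exists 0 => ? []. Qed.

Lemma opnorm_ne (f : dual) :
  [set M | 0 <= M /\ forall x, nr (f x) <= M * nr x] !=set0.
Proof. by have /dual_elemP[_ [M M0 fM]] := dual_valE f; exists M. Qed.

Lemma opnorm_ge0 (f : dual) : 0 <= opnorm f.
Proof. by apply: lb_le_inf; [exact: opnorm_ne|move=> ? []]. Qed.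

Lemma opnormP (f : dual) x : nr (f x) <= opnorm f * nr x.
Proof.
have [x0|x0] := eqVneq x 0; first by rewrite x0 linear0 !nr0 mulr0.
have nx : 0 < nr x by rewrite lt_def nr_ge0 nr_eq0 x0.
rewrite -ler_pdivrMr//; apply: lb_le_inf; first exact: opnorm_ne.
by move=> M [_ /(_ x)]; rewrite ler_pdivrMr.
Qed.

Lemma opnormZ (r : R) (f : dual) : 0 < r -> opnorm (r%:C *: f) = r * opnorm f.
Proof.
move=> r0; apply/eqP; rewrite eq_le; apply/andP; split.
  apply: opnorm_le; first by rewrite mulr_ge0 ?opnorm_ge0// ltW.
  move=> x; rewrite dualE_Z nrM (nr_real (ltW r0)) -mulrA ler_pM2l//; exact: opnormP.
rewrite -ler_pdivlMl//; apply: opnorm_le.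
  by rewrite mulr_ge0 ?opnorm_ge0// invr_ge0 ltW.
move=> x; rewrite -mulrA ler_pdivlMl//.
have := opnormP (r%:C *: f) x; by rewrite dualE_Z nrM (nr_real (ltW r0)).
Qed.

Lemma opnormN (f : dual) : opnorm (- f) = opnorm f.
Proof.
have H g : opnorm (- g) <= opnorm g.
  by apply: opnorm_le; [exact: opnorm_ge0|move=> x; rewrite dualE_N nrN opnormP].
by apply/eqP; rewrite eq_le H -{1}(opprK f) H.
Qed.

Lemma norming_dual (x : E) : exists f : dual,
  (forall y, nr (f y) <= nr y) /\ nr (f x) = nr x.
Proof.
have [f [lf fle fx]] := norming_functional x.
have hf : dual_elem f.
  by apply/dual_elemP; split=> //; exists 1 => // y; rewrite mul1r.
by exists (to_dual hf); split=> //=; rewrite fx nr_real// nr_ge0.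
Qed.

(** Gram-Schmidt: g detects the part of v off the line of u and is corrected to kill u, then f is
    corrected to kill v. [dual3] adds a third vector in the same way. *)
Lemma dual2 (u v : E) : u != 0 -> (forall c, v <> c *: u) ->
  exists a b : dual, [/\ a u = 1, a v = 0, b u = 0 & b v = 1].
Proof.
move=> /dual_sep[f fu] vu.
have [|g gy] := dual_sep (x := v - f v *: u).
  by rewrite subr_eq0; apply/eqP/vu.
pose b := g - g u *: f.
have bu : b u = 0 by rewrite /b dualE_B dualE_Z fu mulr1 subrr.
have bv : b v = 1.
  by rewrite -[RHS]gy /b dualE_B dualE_Z dual_B dual_Z mulrC.
exists (f - f v *: b), b; split=> //.
  by rewrite dualE_B dualE_Z bu mulr0 subr0.
by rewrite dualE_B dualE_Z bv mulr1 subrr.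
Qed.

Lemma dual3 (u v w : E) (a b : dual) :
  [/\ a u = 1, a v = 0, b u = 0 & b v = 1] -> (forall c d, w <> c *: u + d *: v) ->
  exists a' b' c' : dual, [/\ [/\ a' u = 1, a' v = 0 & a' w = 0],
    [/\ b' u = 0, b' v = 1 & b' w = 0] & [/\ c' u = 0, c' v = 0 & c' w = 1]].
Proof.
move=> [au av bu bv] wuv.
have [|g gy] := dual_sep (x := w - (a w *: u + b w *: v)).
  by rewrite subr_eq0; apply/eqP/wuv.
pose c := g - g u *: a - g v *: b.
have cu : c u = 0 by rewrite /c !dualE_B !dualE_Z au bu; ring.
have cv : c v = 0 by rewrite /c !dualE_B !dualE_Z av bv; ring.
have cw : c w = 1.
  by rewrite -[RHS]gy /c !dualE_B !dualE_Z dual_B dual_D !dual_Z; ring.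
exists (a - a w *: c), (b - b w *: c), c.
by split; split; rewrite // ?dualE_B ?dualE_Z ?cu ?cv ?cw ?au ?av ?bu ?bv; ring.
Qed.

End Dual.

Section DualComplete.
Variables (R : realType) (E : completeNormedModType R[i]).

(** Completeness of the scalars is inherited from E by embedding them as the line through x; a
    norming functional of x reads the limit back without loss in the constant. *)
Lemma complex_geometric_cvg (u : nat -> R[i]) (C : R) : (exists x : E, x != 0) ->
  0 <= C -> (forall n, nr (u n.+1 - u n) <= C * 4^-1 ^+ n) ->
  exists l, forall n, nr (u n - l) <= C * (4 / 3 * 4^-1 ^+ n).
Proof.
move=> [x x0] C0 uC.
have nx0 : nr x != 0 by rewrite nr_eq0.
have nx : 0 < nr x by rewrite lt_def nr_ge0 nx0.
have [f [f1 fx]] := norming_dual x.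
have fx0 : f x != 0 by rewrite -nr_eq0 fx.
have [||y yu] := @geometric_cvg R E (fun n => u n *: x) (C * nr x).
- by rewrite mulr_ge0 ?nr_ge0.
- move=> n; by rewrite -scalerBl nrZ mulrAC ler_wpM2r ?nr_ge0.
exists (f y / f x) => n.
rewrite -(ler_pM2r nx) -{1}fx -nrM mulrBl divfK//.
have -> : u n * f x - f y = f (u n *: x - y) by rewrite dual_B dual_Z.
apply: le_trans (f1 _) _; apply: le_trans (yu n) _.
by rewrite mulrAC.
Qed.

Lemma opnorm_geometric_complete : geometric_complete (@opnorm R E).
Proof.
move=> u uC.
have [nz|/forallNP z] := pselect (exists x : E, x != 0); last first.
  exists 0 => n.
  apply: opnorm_le => [|x].
    by rewrite mulr_ge0// ?exprn_ge0//; lra.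
  by have /negP/negPn/eqP -> := z x; rewrite linear0 !nr0 mulr0.
have uCx x n : nr (u n.+1 x - u n x) <= nr x * 4^-1 ^+ n.
  rewrite -dualE_B; apply: le_trans (opnormP _ _) _.
  by rewrite mulrC ler_wpM2l ?nr_ge0.
pose l x := projT1 (cid (complex_geometric_cvg nz (nr_ge0 x) (uCx x))).
have lP x n : nr (u n x - l x) <= nr x * (4 / 3 * 4^-1 ^+ n).
  exact: (projT2 (cid (complex_geometric_cvg nz (nr_ge0 x) (uCx x)))).
have ll : forall (c : R[i]) (x y : E), l (c *: x + y) = c * l x + l y.
  move=> c x y; apply/subr0_eq/eqP; rewrite -nr_eq0; apply/eqP.
  pose K := nr (c *: x + y) + nr c * nr x + nr y.
  have K0 : 0 <= K by rewrite !addr_ge0 ?mulr_ge0 ?nr_ge0.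
  have bnd n : nr (l (c *: x + y) - (c * l x + l y)) <= K * (4 / 3 * 4^-1 ^+ n).
    have -> : l (c *: x + y) - (c * l x + l y) =
        - (u n (c *: x + y) - l (c *: x + y)) + c * (u n x - l x) + (u n y - l y).
      by rewrite dual_D dual_Z; ring.
    apply: le_trans (nrD _ _) _; rewrite /K (mulrDl _ (nr y)) (mulrDl (nr _)).
    apply: lerD; last exact: lP.
    apply: le_trans (nrD _ _) _; apply: lerD; first by rewrite nrN; exact: lP.
    by rewrite nrM -mulrA ler_wpM2l ?nr_ge0.
  apply/eqP; rewrite eq_le nr_ge0 andbT leNgt; apply/negP => p.
  have lim0 : (fun n => K * (4 / 3 * 4^-1 ^+ n) : R) @ \oo --> K * (4 / 3 * 0).
    apply: cvgM; first exact: cvg_cst.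
    apply: cvgM; first exact: cvg_cst.
    by apply: cvg_expr; rewrite ger0_norm; lra.
  rewrite !mulr0 in lim0.
  have /cvgrPdist_lt /(_ _ p) [n _ /(_ n (leqnn n))] := lim0.
  rewrite /= sub0r normrN ger0_norm; last first.
    by rewrite !mulr_ge0// ?exprn_ge0//; lra.
  by rewrite ltNge bnd.
have hl : dual_elem l.
  apply/dual_elemP; split=> //.
  exists (opnorm (u 0%N) + 4 / 3); first by rewrite addr_ge0 ?opnorm_ge0//; lra.
  move=> x; have -> : l x = u 0%N x - (u 0%N x - l x) by rewrite opprB addrC subrK.
  apply: le_trans (nrD _ _) _; rewrite nrN mulrDl lerD ?opnormP//.
  by have := lP x 0%N; rewrite expr0 mulr1 mulrC.
exists (to_dual hl) => n; apply: opnorm_le => [|x].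
  by rewrite mulr_ge0// ?exprn_ge0//; lra.
by rewrite dualE_B /= mulrC.
Qed.

End DualComplete.

(** * Rank-one operators *)

Section TensorLike.
Variable K : fieldType.

(* Properties of (u, h) |-> u (x) h that are symmetric in the two factors, so that a result on maps x (x) f |-> Sx (x) Tf also covers the
   maps x (x) f |-> Tf (x) Sx. *)
Record tensor_like (U H M : lmodType K) (t : U -> H -> M) : Prop := TensorLike {
  tDl : forall u v h, t (u + v) h = t u h + t v h;
  tDr : forall u h k, t u (h + k) = t u h + t u k;
  tZl : forall c u h, t (c *: u) h = c *: t u h;
  tZr : forall c u h, t u (c *: h) = c *: t u h;
  t_eq0 : forall u h, t u h = 0 -> u = 0 \/ h = 0;
  t_rank : forall u v w h k l, t u h + t v k = t w l -> u != 0 -> h != 0 ->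
    (exists c, v = c *: u) \/ (exists c, k = c *: h) }.

Lemma tensor_like_swap (U H M : lmodType K) (t : U -> H -> M) :
  tensor_like t -> tensor_like (fun h u => t u h).
Proof.
move=> tt; split=> [h k u|h u v|c h u|c h u|h u|h k l u v w].
- exact: tDr.
- exact: tDl.
- exact: tZr.
- exact: tZl.
- by move=> /(t_eq0 tt)[]; [right|left].
- by move=> /(t_rank tt) H' ? ?; case: H' => //; [right|left].
Qed.

Section Fixed.
Variables (U H M : lmodType K) (t : U -> H -> M).
Hypothesis tt : tensor_like t.

Lemma tBl u v h : t (u - v) h = t u h - t v h.
Proof. by rewrite (tDl tt) -scaleN1r (tZl tt) scaleN1r. Qed.

Lemma tBr u h k : t u (h - k) = t u h - t u k.
Proof. by rewrite (tDr tt) -scaleN1r (tZr tt) scaleN1r. Qed.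

Lemma t_injl u v h : h != 0 -> t u h = t v h -> u = v.
Proof.
move=> h0 e; apply: subr0_eq; have : t (u - v) h = 0 by rewrite tBl e subrr.
by move=> /(t_eq0 tt)[//|h1]; rewrite h1 eqxx in h0.
Qed.

Lemma t_injr u h k : u != 0 -> t u h = t u k -> h = k.
Proof.
move=> u0 e; apply: subr0_eq; have : t u (h - k) = 0 by rewrite tBr e subrr.
by move=> /(t_eq0 tt)[u1|//]; rewrite u1 eqxx in u0.
Qed.

(** Since L x0 + L x has rank at most one, L x shares a factor with L x0. Thus V is the union of two
    subspaces, one for each factor, and so equals one of them. *)
Lemma rank1_line_dichotomy (V : lmodType K) (L : V -> M) (x0 : V) (u0 : U) (h0 : H) :
  (forall x y, L (x + y) = L x + L y) ->
  (forall x, exists u h, L x = t u h) ->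
  L x0 = t u0 h0 -> u0 != 0 -> h0 != 0 ->
  (forall x, exists u, L x = t u h0) \/ (forall x, exists h, L x = t u0 h).
Proof.
move=> LD Lt Lx0 u00 h00.
have K12 x : (exists u, L x = t u h0) \/ (exists h, L x = t u0 h).
  have [u [h Lx]] := Lt x; have [w [l Lw]] := Lt (x0 + x).
  have [] // := t_rank tt (u := u0) (v := u) (w := w) (h := h0) (k := h) (l := l).
  - by rewrite -Lx0 -Lx -LD.
  - by move=> [c uc]; right; exists (c *: h); rewrite Lx uc (tZl tt) (tZr tt).
  - by move=> [c hc]; left; exists (c *: u); rewrite Lx hc (tZl tt) (tZr tt).
apply: contrapT => /not_orP[/existsNP[x nx] /existsNP[y ny]].
have [//|[h Lx]] := K12 x; have [[u Ly]|//] := K12 y.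
have [[w Lw]|[l Ll]] := K12 (x + y).
  by apply: nx; exists (w - u); rewrite tBl -Lw -Ly LD addrK.
by apply: ny; exists (l - h); rewrite tBr -Ll -Lx LD addrAC subrr add0r.
Qed.

(** S and T are read off the two lines through (x0, f0). For other x and f, comparing B x f with B
    x0 f and with B x f0 leaves only multiples of u0 (x) h0 or of S x (x) T f; the value at (x + x0,
    f + f0) decides between them and fixes the coefficient. *)
Lemma rank1_bilinear (V W : lmodType K) (B : V -> W -> M) (x0 : V) (f0 : W)
    (u0 : U) (h0 : H) :
  (forall x y f, B (x + y) f = B x f + B y f) ->
  (forall x f g, B x (f + g) = B x f + B x g) ->
  (forall c x f, B (c *: x) f = c *: B x f) ->
  (forall c x f, B x (c *: f) = c *: B x f) ->
  (forall x f, exists u h, B x f = t u h) ->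
  (forall x f, B x f = 0 -> x = 0 \/ f = 0) ->
  x0 != 0 -> f0 != 0 -> B x0 f0 = t u0 h0 ->
  (forall x, exists u, B x f0 = t u h0) ->
  (forall f, exists h, B x0 f = t u0 h) ->
  exists (S : V -> U) (T : W -> H),
    [/\ forall c x y, S (c *: x + y) = c *: S x + S y,
        forall c f g, T (c *: f + g) = c *: T f + T g,
        forall x f, B x f = t (S x) (T f), S x0 = u0 & T f0 = h0].
Proof.
move=> BDl BDr BZl BZr Bt B0 x00 f00 Be BS BT.
have [u00 h00] : u0 != 0 /\ h0 != 0.
  suff : ~ (u0 = 0 \/ h0 = 0) by move=> /not_orP[/eqP ? /eqP ?].
  have t0l h : t 0 h = 0 by rewrite -(scale0r 0) (tZl tt) scale0r.
  have t0r u : t u 0 = 0 by rewrite -(scale0r 0) (tZr tt) scale0r.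
  have : B x0 f0 <> 0 by move=> /B0[/eqP|/eqP]; apply/negP.
  by rewrite Be => + [] e; rewrite e ?t0l ?t0r.
have [S SP] := choice BS; have [T TP] := choice BT.
have Sl c x y : S (c *: x + y) = c *: S x + S y.
  by apply: (t_injl h00); rewrite -SP BDl BZl !SP (tDl tt) (tZl tt).
have Tl c x y : T (c *: x + y) = c *: T x + T y.
  by apply: (t_injr u00); rewrite -TP BDr BZr !TP (tDr tt) (tZr tt).
have Sx0 : S x0 = u0 by apply: (t_injl h00); rewrite -SP -Be.
have Tf0 : T f0 = h0 by apply: (t_injr u00); rewrite -TP -Be.
have SZ c x : S (c *: x) = c *: S x.
  by apply: (t_injl h00); rewrite -SP BZl !SP (tZl tt).
have TZ c x : T (c *: x) = c *: T x.
  by apply: (t_injr u00); rewrite -TP BZr !TP (tZr tt).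
have S_inj x : S x = 0 -> x = 0.
  move=> Sx; have : B x f0 = 0 by rewrite SP Sx -(scale0r 0) (tZl tt) scale0r.
  by move=> /B0[//|/eqP]; rewrite (negPf f00).
have T_inj f : T f = 0 -> f = 0.
  move=> Tf; have : B x0 f = 0 by rewrite TP Tf -(scale0r 0) (tZr tt) scale0r.
  by move=> /B0[/eqP|//]; rewrite (negPf x00).
exists S, T; split=> // x f.
have [[c xc]|nx] := pselect (exists c, x = c *: x0).
  by rewrite xc BZl SZ TP Sx0 (tZl tt).
have [[c fc]|nf] := pselect (exists c, f = c *: f0).
  by rewrite fc BZr TZ SP Tf0 (tZr tt).
have nS c : S x <> c *: u0.
  move=> e; apply: nx; exists c; apply/subr0_eq/S_inj.
  by rewrite -scaleNr addrC Sl Sx0 e -scalerDl addNr scale0r.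
have nT c : T f <> c *: h0.
  move=> e; apply: nf; exists c; apply/subr0_eq/T_inj.
  by rewrite -scaleNr addrC Tl Tf0 e -scalerDl addNr scale0r.
have Sxn : S x != 0 by apply/eqP => e; apply: (nS 0); rewrite scale0r.
have Tfn : T f != 0 by apply/eqP => e; apply: (nT 0); rewrite scale0r.
have [w [k Bxf]] := Bt x f.
have full : B (x + x0) (f + f0) = B x f + t u0 (T f) + t (S x) h0 + t u0 h0.
  rewrite BDl !BDr !TP SP Tf0 addrA; congr (_ + _); exact: addrAC.
have [z [l zl]] := Bt (x + x0) (f + f0).
have H1 : (exists c, w = c *: u0) \/ (exists c, k = c *: T f).
  have [w' [l' e]] := Bt (x0 + x) f.
  by apply: (t_rank tt) u00 Tfn; rewrite -TP -Bxf -BDl e.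
have H2 : (exists c, w = c *: S x) \/ (exists c, k = c *: h0).
  have [w' [l' e]] := Bt x (f0 + f).
  by apply: (t_rank tt) Sxn h00; rewrite -SP -Bxf -BDr e.
(* Otherwise B (x + x0) (f + f0) = u0 (x) (T f + (c + 1) h0) + S x (x) h0 would have rank two. *)
have bad c : B x f = c *: t u0 h0 -> False.
  move=> e; have : t u0 (T f + (c + 1) *: h0) + t (S x) h0 = t z l.
    rewrite -zl full e (tDr tt) (tZr tt) scalerDl scale1r.
    by rewrite [RHS]addrAC addrA [c *: _ + t u0 (T f)]addrC.
  move=> /(t_rank tt)/(_ u00)[|[d Sd]|[d hd]].
  - by apply/eqP => e'; apply: (nT (- (c + 1))); apply/eqP; rewrite scaleNr -addr_eq0 e'.
  - exact: (nS d).
  - have [d0|d0] := eqVneq d 0; first by move: h00; rewrite hd d0 scale0r eqxx.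
    apply: (nT (d^-1 - (c + 1))); rewrite scalerBl; apply/eqP.
    by rewrite eq_sym subr_eq eq_sym; apply/eqP; rewrite [in RHS]hd scalerA mulVf// scale1r.
have t00 : B x f <> 0 by move=> e; apply: (bad 0); rewrite e scale0r.
have [c Bc] : exists c, B x f = c *: t (S x) (T f).
  case: H1 => [[c1 wc1]|[c1 kc1]]; case: H2 => [[c2 wc2]|[c2 kc2]].
  - have c20 : c2 != 0.
      by apply/eqP => c20; apply: t00; rewrite Bxf wc2 c20 (tZl tt) scale0r.
    exfalso; apply: (nS (c2^-1 * c1)); rewrite -scalerA -wc1 wc2 scalerA mulVf//.
    by rewrite scale1r.
  - by exfalso; apply: (bad (c1 * c2)); rewrite Bxf wc1 kc2 (tZl tt) (tZr tt) scalerA.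
  - by exists (c2 * c1); rewrite Bxf wc2 kc1 (tZl tt) (tZr tt) scalerA.
  - have c20 : c1 != 0.
      by apply/eqP => c10; apply: t00; rewrite Bxf kc1 c10 (tZr tt) scale0r.
    exfalso; apply: (nT (c1^-1 * c2)); rewrite -scalerA -kc2 kc1 scalerA mulVf//.
    by rewrite scale1r.
(* As S x and u0 are independent, c T f + h0 and T f + h0 must be proportional; independence of T f
   and h0 then gives c = 1. *)
have : t (S x) (c *: T f + h0) + t u0 (T f + h0) = t z l.
  rewrite -zl full Bc !(tDr tt) (tZr tt) !addrA; congr (_ + _).
  by rewrite addrAC.
have ch0 : c *: T f + h0 != 0.
  apply/eqP => e; have [c0|c0] := eqVneq c 0.
    by move: e h00; rewrite c0 scale0r add0r => ->; rewrite eqxx.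
  apply: (nT (- c^-1)); rewrite scaleNr -scalerN.
  have -> : - h0 = c *: T f by apply/eqP; rewrite eq_sym -addr_eq0 e.
  by rewrite scalerA mulVf// scale1r.
move=> /(t_rank tt)/(_ Sxn ch0)[[d ud]|[d hd]].
  have [d0|d0] := eqVneq d 0; first by move: u00; rewrite ud d0 scale0r eqxx.
  by exfalso; apply: (nS d^-1); rewrite ud scalerA mulVf// scale1r.
have e1 : (1 - d * c) *: T f = (d - 1) *: h0.
  rewrite !scalerBl !scale1r -scalerA; apply/eqP.
  by rewrite subr_eq addrAC -scalerDr [h0 + _]addrC -hd addrK.
have dc : d * c = 1.
  apply/eqP; rewrite eq_sym -subr_eq0; apply/negPn/negP => n0.
  apply: (nT ((1 - d * c)^-1 * (d - 1))).
  by rewrite -scalerA -e1 scalerA mulVf// scale1r.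
have d1 : d = 1.
  move: e1; rewrite dc subrr scale0r => /esym/eqP.
  by rewrite scaler_eq0 (negPf h00) orbF subr_eq0 => /eqP.
by rewrite Bc; move: dc; rewrite d1 mul1r => ->; rewrite scale1r.
Qed.

End Fixed.
End TensorLike.

Section Operators.
Variables (R : realType) (E : normedModType R[i]).
Implicit Types (T X : E -> E) (u v w x y z : E) (f g h k : dual E).

Definition tens u h : E -> E := fun z => h z *: u.

Lemma tens_tensor_like : tensor_like (tens : E -> dual E -> (E -> E)).
Proof.
split.
- by move=> u v h; apply/funext => z; rewrite /tens /= scalerDr.
- by move=> u h k; apply/funext => z; rewrite /tens /= scalerDl.
- by move=> c u h; apply/funext => z; rewrite /tens /= scalerA mulrC -scalerA.
- by move=> c u h; apply/funext => z; rewrite /tens /= -scalerA.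
- move=> u h e; have [->|/dual_neq0[z hz]] := eqVneq h 0; [by right|left].
  by have := congr1 (fun T : E -> E => T z) e; rewrite /tens /= hz scale1r.
- move=> u v w h k l e u0 h0.
  have [//|/forallNP nv] := pselect (exists c, v = c *: u); first by left.
  right; have [a [b [au av bu bv]]] := dual2 u0 nv.
  have e' z : h z *: u + k z *: v = l z *: w.
    exact: (congr1 (fun T : E -> E => T z) e).
  have hE z : h z = l z * a w.
    by rewrite -dual_Z -e' dual_D !dual_Z au av; ring.
  have kE z : k z = l z * b w.
    by rewrite -dual_Z -e' dual_D !dual_Z bu bv; ring.
  have aw : a w != 0.
    apply: contra_neq h0 => aw; apply: dual_eq => z; by rewrite hE aw mulr0.
  exists (b w / a w); apply: dual_eq => z; rewrite dualE_Z kE hE; field.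
  exact: aw.
Qed.

Lemma tens_bounded u h : bounded_op (tens u h).
Proof.
split=> [c x y|]; first by rewrite /tens dual_D dual_Z scalerDl scalerA.
exists (opnorm h * nr u) => x.
rewrite !nrE -rmorphM lecR /tens nrZ mulrAC.
by rewrite ler_wpM2r ?nr_ge0// opnormP.
Qed.

Lemma bounded_opP T : bounded_op T <->
  is_linear_op T /\ exists2 M : R, 0 <= M & forall x, nr (T x) <= M * nr x.
Proof.
split=> [[lT [M TM]]|[lT [M M0 TM]]]; split=> //.
  exists `|M| => // x; rewrite -lecR rmorphM /= -!nrE.
  apply: le_trans (TM x) _; rewrite ler_wpM2r// lecR; exact: ler_norm.
by exists M => x; rewrite !nrE -rmorphM /= lecR.
Qed.

Lemma lop_D T x y : is_linear_op T -> T (x + y) = T x + T y.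
Proof. by move=> lT; rewrite -{1}[x]scale1r lT scale1r. Qed.

Lemma lop_0 T : is_linear_op T -> T 0 = 0.
Proof. by move=> lT; apply: (addrI (T 0)); rewrite -lop_D// !addr0. Qed.

Lemma lop_Z T c x : is_linear_op T -> T (c *: x) = c *: T x.
Proof. by move=> lT; rewrite -[c *: x]addr0 lT lop_0// addr0. Qed.

Lemma bounded_comp S T : bounded_op S -> bounded_op T -> bounded_op (S \o T).
Proof.
move=> /bounded_opP[lS [M M0 SM]] /bounded_opP[lT [L L0 TL]].
apply/bounded_opP; split=> [c x y|]; first by rewrite /= lT lS.
exists (M * L); first exact: mulr_ge0.
move=> x /=; apply: le_trans (SM _) _; rewrite -mulrA ler_wpM2l//.
Qed.

Lemma bounded_add S T : bounded_op S -> bounded_op T -> bounded_op (S + T).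
Proof.
move=> /bounded_opP[lS [M M0 SM]] /bounded_opP[lT [L L0 TL]].
apply/bounded_opP; split=> [c x y|].
  have e z : (S + T) z = S z + T z by [].
  by rewrite !e lT lS scalerDr addrACA.
exists (M + L); first exact: addr_ge0.
move=> x /=; apply: le_trans (nrD _ _) _; rewrite mulrDl lerD//.
Qed.

Lemma dual_comp_subproof f T : bounded_op T -> dual_elem (f \o T).
Proof.
move=> /bounded_opP[lT [M M0 TM]]; apply/dual_elemP; split=> [c x y|].
  by rewrite /= lT dual_D dual_Z.
exists (opnorm f * M); first by rewrite mulr_ge0 ?opnorm_ge0.
by move=> x /=; apply: le_trans (opnormP _ _) _; rewrite -mulrA ler_wpM2l ?opnorm_ge0.
Qed.

Definition dual_comp f T (bT : bounded_op T) : dual E := to_dual (dual_comp_subproof f bT).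

Lemma rank_le1P T : bounded_op T -> rank_le T 1 <-> exists u h, T = tens u h.
Proof.
move=> bT; split=> [[ys yT]|[u [h ->]]]; last first.
  exists (fun _ => u) => x; exists (fun _ => h x).
  by rewrite big_ord_recl big_ord0 addr0.
have [y0|/dual_sep[f fy]] := eqVneq (ys ord0) 0.
  exists 0, 0; apply/funext => x; have [c ->] := yT x.
  by rewrite big_ord_recl big_ord0 y0 scaler0 addr0 /tens scaler0.
exists (ys ord0), (dual_comp f bT); apply/funext => x; rewrite /tens /=.
by have [c ->] := yT x; rewrite big_ord_recl big_ord0 addr0 dual_Z fy mulr1.
Qed.

Lemma rank_le_sum n (u : 'I_n -> E) (h : 'I_n -> dual E) :
  rank_le (fun x => \sum_(i < n) tens (u i) (h i) x) n.
Proof. by exists u => x; exists (fun i => h i x). Qed.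

Lemma bounded_sum n (u : 'I_n -> E) (h : 'I_n -> dual E) :
  bounded_op (fun x => \sum_(i < n) tens (u i) (h i) x).
Proof.
elim: n u h => [|n IH] u h.
  apply/bounded_opP; split=> [c x y|]; first by rewrite !big_ord0 scaler0 addr0.
  by exists 0 => // x; rewrite big_ord0 nr0 mul0r.
have -> : (fun x => \sum_(i < n.+1) tens (u i) (h i) x) =
    (fun x => \sum_(i < n) tens (u (lift ord0 i)) (h (lift ord0 i)) x)
      + tens (u ord0) (h ord0).
  by apply/funext => x; rewrite big_ord_recl addrC.
apply: bounded_add; [exact: (IH (fun i => u (lift ord0 i)) (fun i => h (lift ord0 i)))|exact: tens_bounded].
Qed.

(* The trace of a finite-rank operator does not depend on its representation. *)
Lemma trace_zero (s : seq (E * dual E)) :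
  (forall x, \sum_(p <- s) p.2 x *: p.1 = 0) -> \sum_(p <- s) p.2 p.1 = 0.
Proof.
elim: {s}(size s) {-2}s (erefl (size s)) => [[//|//]|n IH [//|[u h] s] /= [sn] s0].
  by rewrite big_nil.
have [h0|/dual_neq0[x hx]] := eqVneq h 0.
  rewrite big_cons h0 add0r; apply: IH => // x.
  by have := s0 x; rewrite big_cons h0 /= scale0r add0r.
(* As h x = 1, u is a combination of the remaining vectors. Substituting it shortens the list at the
   cost of replacing each functional q by q - q x h, and the trace is unchanged. *)
have uE : u = \sum_(p <- s) (- p.2 x) *: p.1.
  have := s0 x; rewrite big_cons /= hx scale1r => /eqP; rewrite addr_eq0 => /eqP ->.
  by rewrite -sumrN; apply: eq_bigr => p _; rewrite scaleNr.
have dsum (k : dual E) (G : E * dual E -> E) r :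
    k (\sum_(p <- r) G p) = \sum_(p <- r) k (G p).
  by elim: r => [|p r IHr]; rewrite ?big_nil ?dual_0// !big_cons dual_D IHr.
have [k kE] : exists k : E * dual E -> dual E,
    forall q y, k q y = q.2 y - q.2 x * h y.
  by exists (fun q : E * dual E => q.2 - q.2 x *: h).
pose s' : seq (E * dual E) := map (fun q => (q.1, k q)) s.
have := IH s'; rewrite size_map => /(_ sn); rewrite /s' big_map /= => IHs.
rewrite -[RHS]IHs.
  rewrite big_cons /= uE dsum -big_split /=; apply: eq_bigr => p _.
  by rewrite kE dual_Z; ring.
move=> y; rewrite big_map /=; have := s0 y.
rewrite big_cons /= uE => s0y; rewrite -[RHS]s0y scaler_sumr -big_split /=.
apply: eq_bigr => p _.
by rewrite kE scalerBl scalerA mulrN scaleNr mulrC addrC.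
Qed.

End Operators.

(** * Standard operator algebras, words and Jordan automorphisms *)

Section Algebra.
Variables (R : realType) (E : normedModType R[i]).
Variables (A : set (E -> E)) (hA : standard_operator_algebra A).
Implicit Types (T X B : E -> E) (u v w x y z : E) (f g h k : dual E).

Definition rank1 T := exists u h, T = tens u h.

Lemma A_bounded T : A T -> bounded_op T. Proof. by case: hA => + _ _ _ _; apply. Qed.

Lemma A_linear T : A T -> is_linear_op T. Proof. by move=> /A_bounded[]. Qed.

Lemma A_tens u h : A (tens u h).
Proof.
case: hA => _ + _ _ _; apply; first exact: tens_bounded.
by exists 1%N; apply/rank_le1P; [exact: tens_bounded|exists u, h].
Qed.

Lemma A_add S T : A S -> A T -> A (S + T).
Proof. by case: hA => _ _ H _ _; exact: H. Qed.

Lemma A_scale c S : A S -> A (c *: S).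
Proof. by case: hA => _ _ _ H _; exact: H. Qed.

Lemma A_comp S T : A S -> A T -> A (S \o T).
Proof. by case: hA => _ _ _ _ H; exact: H. Qed.

Lemma A_zero : A 0.
Proof.
suff -> : (0 : E -> E) = tens 0 0 by exact: A_tens.
by apply/funext => z; rewrite /tens scaler0.
Qed.

Lemma A_word a b r s : A a -> A b -> A (iter r b \o a \o iter s b).
Proof.
move=> Aa Ab; have H : A (iter r b \o a).
  elim: r => [//|r IH]; have -> : iter r.+1 b \o a = b \o (iter r b \o a) by [].
  exact: A_comp.
elim: s => [|s IH]; first by rewrite [X in A X](_ : _ = iter r b \o a)//.
have -> : iter r b \o a \o iter s.+1 b = (iter r b \o a \o iter s b) \o b.
  by apply/funext => z /=; rewrite -iterSr.
exact: A_comp.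
Qed.

Lemma bounded_iter n T : bounded_op T -> bounded_op (iter n T).
Proof.
move=> bT; elim: n => [|n IH]; last exact: (bounded_comp bT IH).
by split=> // ; exists 1 => x; rewrite mul1r.
Qed.

Lemma tens0 : tens 0 0 = 0 :> (E -> E).
Proof. by apply/funext => z; rewrite /tens scaler0. Qed.

Lemma comp_tens T u h : is_linear_op T -> T \o tens u h = tens (T u) h.
Proof. by move=> lT; apply/funext => z; rewrite /tens /= lop_Z. Qed.

Lemma iter_tens_u n u h : iter n (tens u h) u = h u ^+ n *: u.
Proof.
elim: n => [|n IH]; first by rewrite scale1r.
by rewrite iterS IH /tens dual_Z exprSr.
Qed.

Lemma iter_tens n u h z : iter n.+1 (tens u h) z = (h u ^+ n * h z) *: u.
Proof.
elim: n => [|n IH]; first by rewrite mul1r.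
by rewrite iterS IH /tens dual_Z exprSr mulrAC.
Qed.

(* In the two following lemmas g y is the trace of the word. *)
Lemma word_rank1_mid B r s x f : bounded_op B -> exists y g,
  iter r B \o tens x f \o iter s B = tens y g /\ g y = f (iter (r + s) B x).
Proof.
move=> bB; have bs := bounded_iter s bB; have [lr _] := bounded_iter r bB.
exists (iter r B x), (dual_comp f bs); split; first by rewrite comp_tens.
by rewrite /= -iterD addnC.
Qed.

Lemma word_rank1_ends T r s u h : bounded_op T -> (0 < r + s)%N -> exists y g,
  iter r (tens u h) \o T \o iter s (tens u h) = tens y g /\
  g y = h u ^+ (r + s).-1 * h (T u).
Proof.
move=> bT; case: r => [|r].
  case: s => [//|s] _.
  exists (T u), (h u ^+ s *: h); split.
    apply/funext => z.
    have -> : ((iter 0 (tens u h) \o T) \o iter s.+1 (tens u h)) z =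
      T (iter s.+1 (tens u h) z) by [].
    by rewrite iter_tens lop_Z//; case: bT.
  by rewrite dualE_Z.
move=> _; have bs := bounded_iter s (tens_bounded u h).
exists u, (h u ^+ r *: dual_comp (dual_comp h bT) bs); split.
  by apply/funext => z; rewrite /comp iter_tens.
rewrite dualE_Z /= iter_tens_u lop_Z; last by case: bT.
by rewrite dual_Z exprD mulrA.
Qed.

Lemma tens_trace u v h k : tens u h = tens v k -> h u = k v.
Proof.
move=> e; have := @trace_zero R E [:: (u, h); (- v, k)].
rewrite !big_cons !big_nil /= !addr0 -scaleN1r dual_Z mulN1r => H.
apply/subr0_eq/H => x; rewrite !big_cons big_nil /= addr0.
have := congr1 (fun T : E -> E => T x) e; rewrite /tens => ->.
by rewrite scaleN1r scalerN subrr.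
Qed.

Lemma tens2_trace u1 u2 v1 v2 h1 h2 k1 k2 :
  tens u1 h1 + tens u2 h2 = tens v1 k1 + tens v2 k2 ->
  h1 u1 + h2 u2 = k1 v1 + k2 v2.
Proof.
move=> e; have := @trace_zero R E [:: (u1, h1); (u2, h2); (- v1, k1); (- v2, k2)].
rewrite !big_cons !big_nil /= !addr0 -(scaleN1r v1) -(scaleN1r v2) !dual_Z => H.
apply/subr0_eq; rewrite -[RHS]H; first by ring.
move=> x; rewrite !big_cons big_nil /= addr0.
have := congr1 (fun T : E -> E => T x) e.
have -> : (tens u1 h1 + tens u2 h2) x = h1 x *: u1 + h2 x *: u2 by [].
have -> : (tens v1 k1 + tens v2 k2) x = k1 x *: v1 + k2 x *: v2 by [].
by rewrite addrA => ->; rewrite !scaleN1r !scalerN -opprD subrr.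
Qed.

Section Jordan.
Variables (th : (E -> E) -> (E -> E)) (jth : jordan_automorphism A th).

Definition jprod S T : E -> E := (S \o T) + (T \o S).

Lemma A_jprod S T : A S -> A T -> A (jprod S T).
Proof. by move=> ? ?; apply: A_add; exact: A_comp. Qed.

Lemma jth_A a : A a -> A (th a). Proof. by case: jth => -[+ _ _ _] _; apply. Qed.

Lemma jth_lin c a b : A a -> A b -> th (c *: a + b) = c *: th a + th b.
Proof. by move=> Aa Ab; case: jth => -[_ _ _ +] _; apply. Qed.

Lemma jth_D a b : A a -> A b -> th (a + b) = th a + th b.
Proof. by move=> Aa Ab; rewrite -[a]scale1r jth_lin// !scale1r. Qed.

Lemma jth_0 : th 0 = 0.
Proof. by apply: (addrI (th 0)); rewrite -jth_D ?addr0//; exact: A_zero. Qed.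

Lemma jth_Z c a : A a -> th (c *: a) = c *: th a.
Proof. by move=> Aa; rewrite -[c *: a]addr0 jth_lin ?jth_0 ?addr0//; exact: A_zero. Qed.

Lemma jth_jprod a b : A a -> A b -> th (jprod a b) = jprod (th a) (th b).
Proof. by move=> Aa Ab; case: jth => _; apply. Qed.

Lemma jprod_diag S : jprod S S = 2 *: (S \o S).
Proof. by rewrite scaler_nat mulr2n. Qed.

Lemma jth_square a : A a -> th (a \o a) = th a \o th a.
Proof.
move=> Aa; have two : (2 : R[i]) != 0 by rewrite pnatr_eq0.
apply: (scalerI two); rewrite -jth_Z; last exact: A_comp.
by rewrite -!jprod_diag jth_jprod.
Qed.

(** The triple product a X a is a Jordan polynomial, so Jordan automorphisms preserve it although
    they need not preserve products. The coefficients are those for ab + ba without the factor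
    1/2. *)
Lemma jordan_triple a X : is_linear_op a -> is_linear_op X ->
  4 *: (a \o X \o a) = 2 *: jprod a (jprod a X) + (-1) *: jprod (jprod a a) X.
Proof.
move=> la lX; apply/funext => z.
have e1 : (4 *: (a \o X \o a)) z = 4 *: a (X (a z)) by [].
have e2 : (2 *: jprod a (jprod a X) + (-1) *: jprod (jprod a a) X) z =
  2 *: (a (a (X z) + X (a z)) + (a (X (a z)) + X (a (a z)))) +
  (-1) *: ((a (a (X z)) + a (a (X z))) + X (a (a z) + a (a z))) by [].
rewrite e1 e2 !(lop_D _ _ la) !(lop_D _ _ lX); apply: dual_inj => f.
by rewrite !(dual_D, dual_Z); ring.
Qed.

Lemma jth_triple a X : A a -> A X -> th (a \o X \o a) = th a \o th X \o th a.
Proof.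
move=> Aa AX; have four : (4 : R[i]) != 0 by rewrite pnatr_eq0.
have Aj S T := @A_jprod S T.
apply: (scalerI four); rewrite -jth_Z; last by do 2!apply: A_comp => //.
rewrite !jordan_triple; try by apply: A_linear => //; exact: jth_A.
rewrite jth_D ?jth_Z; try by do ?[exact: Aj|apply: A_scale|apply: (Aj _ _)].
rewrite !jth_jprod //; exact: Aj.
Qed.

(** For c of rank one, c X c is a multiple of c for every X, and [jth_triple] transfers this to th
    c. Choosing X with th X = w (x) k and k (th c z) = 1 puts th c w on the line of th c z. The
    trace is recovered from c^2 = tr(c) c. *)
Lemma jth_tens y g : exists y' g', th (tens y g) = tens y' g' /\ g' y' = g y.
Proof.
set c := tens y g; have Ac : A c by exact: A_tens.
have [inj sur] : (forall a b, A a -> A b -> th a = th b -> a = b) /\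
    (forall b, A b -> exists2 a, A a & th a = b) by case: jth => -[].
have [c0|c0] := pselect (th c = 0).
  exists 0, 0; rewrite c0 tens0; split=> //; rewrite dual_0.
  have : c = 0 by apply: inj => //; [exact: A_zero|rewrite c0 jth_0].
  move=> /(t_eq0 (tens_tensor_like _))[->|->]; by rewrite ?dual_0.
have [z cz] : exists z, th c z <> 0.
  by apply: contrapT => H; apply: c0; apply/funext => z; apply: contrapT => nz; apply: H; exists z.
have [k kv] : exists k : dual E, k (th c z) = 1 by apply: dual_sep; apply/eqP.
have bc : bounded_op (th c) by apply/A_bounded/jth_A.
have [lc _] := bc.
have rk w : th c w = k (th c w) *: th c z.
  have [X AX XE] := sur _ (A_tens w k).
  have e : c \o X \o c = g (X y) *: c.
    apply/funext => x; rewrite /c /tens /=.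
    have -> : (g (X y) *: (fun z => g z *: y)) x = g (X y) *: (g x *: y) by [].
    by rewrite lop_Z ?dual_Z; [rewrite scalerA mulrC|exact: A_linear].
  have := jth_triple Ac AX; rewrite e jth_Z// XE => /(congr1 (fun T : E -> E => T z)).
  have -> : (th c \o tens w k \o th c) z = th c (k (th c z) *: w) by [].
  have -> : (g (X y) *: th c) z = g (X y) *: th c z by [].
  by rewrite kv scale1r => <-; rewrite dual_Z kv mulr1.
have thE : th c = tens (th c z) (dual_comp k bc) by apply/funext.
exists (th c z), (dual_comp k bc); split=> //.
have := jth_square Ac.
have -> : c \o c = g y *: c.
  by apply/funext => x; rewrite /c /tens /= dual_Z mulrC -scalerA.
rewrite jth_Z// => /(congr1 (fun T : E -> E => k (T z))).
have -> : (g y *: th c) z = g y *: th c z by [].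
by rewrite dual_Z kv mulr1.
Qed.

End Jordan.

Lemma algebra_jordan th : algebra_automorphism A th -> jordan_automorphism A th.
Proof.
move=> [lth mth]; split=> // a b Aa Ab; case: lth => _ _ _ lin.
have lin1 c d : A c -> A d -> th (c + d) = th c + th d.
  move=> Ac Ad; have := lin 1 c d Ac Ad.
  have e X : opscale 1 X = X by apply/funext => z; rewrite /opscale scale1r.
  by rewrite !e.
have e := lin1 _ _ (A_comp Aa Ab) (A_comp Ab Aa).
by rewrite -!mth//; exact: e.
Qed.

End Algebra.

(** * Generalized products evaluated at only two operators *)

Section GenProd.
Variables (R : realType) (E : normedModType R[i]) (k : nat).

Lemma gen_prod_cat (s t : seq 'I_k) (T : 'I_k -> E -> E) :
  gen_prod (s ++ t) T = gen_prod s T \o gen_prod t T.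
Proof. by elim: s => [//|i s IH]; rewrite /gen_prod /= -/(gen_prod _ _) IH. Qed.

Lemma gen_prod_const (s : seq 'I_k) (T : 'I_k -> E -> E) b :
  (forall i, i \in s -> T i = b) -> gen_prod s T = iter (size s) b.
Proof.
elim: s => [//|i s IH] Tb; rewrite /gen_prod /= -/(gen_prod _ _) IH.
  by rewrite Tb ?mem_head//; apply/funext.
by move=> j js; apply: Tb; rewrite in_cons js orbT.
Qed.

Lemma split_once (idx : seq 'I_k) p : count_mem p idx = 1%N -> exists s t,
  [/\ idx = s ++ p :: t, p \notin s & p \notin t].
Proof.
move=> c1; have pi : p \in idx by rewrite -has_pred1 has_count c1.
case/splitPr: pi c1 => s t; rewrite count_cat /= eqxx => c1.
move: c1; rewrite add1n addnS => -[/eqP]; rewrite addn_eq0 => /andP[/eqP cs /eqP ct].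
by exists s, t; split=> //; rewrite -has_pred1 has_count ?cs ?ct.
Qed.

Lemma gen_prod_word s t p (T : 'I_k -> E -> E) b : p \notin s -> p \notin t ->
  (forall i, i != p -> T i = b) ->
  gen_prod (s ++ p :: t) T = iter (size s) b \o T p \o iter (size t) b.
Proof.
move=> ps pt Tb; rewrite gen_prod_cat (gen_prod_const (s := s) (b := b)); last first.
  by move=> i si; apply: Tb; apply: contraNneq ps => <-.
rewrite /gen_prod /= -/(gen_prod _ _) (gen_prod_const (s := t) (b := b))//.
by move=> i si; apply: Tb; apply: contraNneq pt => <-.
Qed.

End GenProd.

(** * Rank-one operators are mapped to rank-one operators *)

Section DiagOp.
Variables (R : realType) (E : normedModType R[i]) (n : nat).
Variables (c : 'I_n -> R[i]) (x : 'I_n -> E) (f : 'I_n -> dual E).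
Hypothesis fx : forall i j, f i (x j) = (i == j)%:R.

Definition diag_op : E -> E := fun z => \sum_(i < n) tens (c i *: x i) (f i) z.

Lemma diag_op_bounded : bounded_op diag_op. Proof. exact: bounded_sum. Qed.

Lemma diag_op_rank : rank_le diag_op n. Proof. exact: rank_le_sum. Qed.

Lemma diag_op_x j : diag_op (x j) = c j *: x j.
Proof.
rewrite /diag_op (bigD1 j)//= /tens fx eqxx scale1r big1 ?addr0// => i ij.
by rewrite fx (negPf ij) scale0r.
Qed.

Lemma diag_op_f i z : f i (diag_op z) = c i * f i z.
Proof.
rewrite /diag_op linear_sum (bigD1 i)//= /tens !dual_Z fx eqxx big1 ?addr0 => [|j ij].
  by rewrite mulr1 mulrC.
by rewrite !dual_Z fx eq_sym (negPf ij) !mulr0.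
Qed.

(** [x j] is an eigenvector of [diag_op] for [c j], and [f i] one of its dual for [c i]. *)
Lemma diag_op_word Z r s i j : is_linear_op Z ->
  f i ((iter r diag_op \o Z \o iter s diag_op) (x j)) = c i ^+ r * c j ^+ s * f i (Z (x j)).
Proof.
move=> lZ; have ix m : iter m diag_op (x j) = c j ^+ m *: x j.
  elim: m => [|m IH]; first by rewrite scale1r.
  rewrite iterS IH lop_Z; last by case: diag_op_bounded.
  by rewrite diag_op_x scalerA exprSr.
have fi m z : f i (iter m diag_op z) = c i ^+ m * f i z.
  elim: m => [|m IH]; first by rewrite mul1r.
  by rewrite iterS diag_op_f IH mulrA exprS.
by rewrite /= fi ix lop_Z// dual_Z mulrA.
Qed.

End DiagOp.

Section Minors.
Variables (R : realType) (E : normedModType R[i]).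
Implicit Types (T X B Z : E -> E) (u v w x y z : E) (f g h k : dual E).

Definition minor2 Z := forall x1 x2 f1 f2,
  [/\ f1 x1 = 1, f1 x2 = 0, f2 x1 = 0 & f2 x2 = 1] ->
  f1 (Z x1) * f2 (Z x2) = f1 (Z x2) * f2 (Z x1).

Definition biorth3 x1 x2 x3 f1 f2 f3 :=
  [/\ [/\ f1 x1 = 1, f1 x2 = 0 & f1 x3 = 0],
      [/\ f2 x1 = 0, f2 x2 = 1 & f2 x3 = 0] &
      [/\ f3 x1 = 0, f3 x2 = 0 & f3 x3 = 1]].

Definition det3 (a11 a12 a13 a21 a22 a23 a31 a32 a33 : R[i]) :=
  a11 * (a22 * a33 - a23 * a32) - a12 * (a21 * a33 - a23 * a31)
  + a13 * (a21 * a32 - a22 * a31).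

Definition sympow r s (b c : R[i]) := b ^+ r * c ^+ s + b ^+ s * c ^+ r.

(** The 3x3 minor of B^r Z B^s + B^s Z B^r for B diagonal with eigenvalues b1, b2, b3. The
    eigenvalues stay free because different choices give independent relations on Z. *)
Definition minor3 r s Z := forall x1 x2 x3 f1 f2 f3, biorth3 x1 x2 x3 f1 f2 f3 ->
  forall b1 b2 b3, let q := sympow r s in
  det3 (q b1 b1 * f1 (Z x1)) (q b1 b2 * f1 (Z x2)) (q b1 b3 * f1 (Z x3))
       (q b2 b1 * f2 (Z x1)) (q b2 b2 * f2 (Z x2)) (q b2 b3 * f2 (Z x3))
       (q b3 b1 * f3 (Z x1)) (q b3 b2 * f3 (Z x2)) (q b3 b3 * f3 (Z x3)) = 0.

Lemma minor2_words r s Z : is_linear_op Z ->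
  (forall B, bounded_op B -> rank_le B 2 -> rank1 (iter r B \o Z \o iter s B)) ->
  minor2 Z.
Proof.
move=> lZ H x1 x2 f1 f2 [f11 f12 f21 f22].
pose x (i : 'I_2) := [:: x1; x2]`_i.
pose f (i : 'I_2) : dual E := [:: f1; f2]`_i.
(* With all eigenvalues 1 the entries of the word are those of Z itself, whatever r and s are. *)
pose c (i : 'I_2) : R[i] := 1.
have fx i j : f i (x j) = (i == j)%:R.
  by case: i j => [[|[|//]] ?] [[|[|//]] ?].
have [u [h Wuh]] := H _ (diag_op_bounded c x f) (diag_op_rank c x f).
have W i j : f i (Z (x j)) = h (x j) * f i u.
  have := diag_op_word c fx r s i j lZ.
  by rewrite Wuh /tens dual_Z !expr1n !mul1r => ->.
have := (W ord0 ord0, W ord0 ord_max, W ord_max ord0, W ord_max ord_max).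
by rewrite /x /f /= => -[[[-> ->] ->] ->]; ring.
Qed.

Lemma minor3_words r s Z : is_linear_op Z ->
  (forall B, bounded_op B -> rank_le B 3 -> exists u1 h1 u2 h2,
    (iter r B \o Z \o iter s B) + (iter s B \o Z \o iter r B) =
    tens u1 h1 + tens u2 h2) ->
  minor3 r s Z.
Proof.
move=> lZ H x1 x2 x3 f1 f2 f3 [[f11 f12 f13] [f21 f22 f23] [f31 f32 f33]] b1 b2 b3 q.
pose x (i : 'I_3) := [:: x1; x2; x3]`_i.
pose f (i : 'I_3) : dual E := [:: f1; f2; f3]`_i.
pose c (i : 'I_3) : R[i] := [:: b1; b2; b3]`_i.
have fx i j : f i (x j) = (i == j)%:R.
  by case: i j => [[|[|[|//]]] ?] [[|[|[|//]]] ?].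
have [u1 [h1 [u2 [h2 Wuh]]]] := H _ (diag_op_bounded c x f) (diag_op_rank c x f).
have W i j : q (c i) (c j) * f i (Z (x j)) = h1 (x j) * f i u1 + h2 (x j) * f i u2.
  have := congr1 (fun T : E -> E => f i (T (x j))) Wuh.
  have -> : (tens u1 h1 + tens u2 h2) (x j) = h1 (x j) *: u1 + h2 (x j) *: u2 by [].
  have -> : f i (h1 (x j) *: u1 + h2 (x j) *: u2) = h1 (x j) * f i u1 + h2 (x j) * f i u2.
    by rewrite dual_D !dual_Z.
  move=> <-; set B := diag_op c x f.
  have -> : ((iter r B \o Z \o iter s B) + (iter s B \o Z \o iter r B)) (x j) =
    (iter r B \o Z \o iter s B) (x j) + (iter s B \o Z \o iter r B) (x j) by [].
  by rewrite dual_D !diag_op_word// mulrDl.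
pose o2 : 'I_3 := Ordinal (isT : (1 < 3)%N).
have := (W ord0 ord0, W ord0 o2, W ord0 ord_max).
rewrite /x /f /c /= => -[[-> ->] ->].
have := (W o2 ord0, W o2 o2, W o2 ord_max).
rewrite /x /f /c /= => -[[-> ->] ->].
have := (W ord_max ord0, W ord_max o2, W ord_max ord_max).
rewrite /x /f /c /= => -[[-> ->] ->].
by rewrite /det3; ring.
Qed.

(* Coefficients (1,1,1) and (1,1,2) give two relations between z12 z33 and z13 z32,
   where zij = fi (Z xj); replacing x3 by x3 + a x1 + b x2 then gives z32 = 0. *)
Lemma minor3_col r s Z x1 x2 x3 f1 f2 f3 : r != s -> is_linear_op Z ->
  minor3 r s Z -> biorth3 x1 x2 x3 f1 f2 f3 ->
  f1 (Z x1) = 0 -> f2 (Z x1) = 1 -> f3 (Z x1) = 0 -> f3 (Z x2) = 0.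
Proof.
move=> rs lZ m3 bi z11 z21 z31.
have key y3 g1 g2 : biorth3 x1 x2 y3 g1 g2 f3 -> g1 (Z x1) = 0 -> g2 (Z x1) = 1 ->
    g1 (Z x2) * f3 (Z y3) = 0 /\ g1 (Z y3) * f3 (Z x2) = 0.
  move=> bi' y11 y21.
  have e1 := m3 _ _ _ _ _ _ bi' 1 1 1; have e2 := m3 _ _ _ _ _ _ bi' 1 1 2.
  move: e1 e2; rewrite /det3 /sympow !expr1n !mul1r !mulr1 y11 y21 z31 => e1 e2.
  (* Up to sign the determinants are 8 (z12 z33 - z13 z32) and 8 p q z12 z33 - 2 (p + q)^2 z13 z32.
     Together they give 2 (p - q)^2 z13 z32 = 0, and p <> q because r <> s. *)
  set p := 2 ^+ r in e2; set q := 2 ^+ s in e2.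
  have w : g1 (Z x2) * f3 (Z y3) = g1 (Z y3) * f3 (Z x2).
    apply: (@mulfI _ 8); first by rewrite pnatr_eq0.
    by apply/subr0_eq; rewrite -[RHS]oppr0 -e1; ring.
  have pq : (p - q) ^+ 2 != 0.
    rewrite sqrf_eq0 subr_eq0 /p /q -!natrX eqr_nat eqn_exp2l//.
  have w0 : g1 (Z y3) * f3 (Z x2) = 0.
    apply: (mulfI pq); apply: (@mulfI _ 2); first by rewrite pnatr_eq0.
    transitivity (0 + 8 * p * q * (g1 (Z x2) * f3 (Z y3) - g1 (Z y3) * f3 (Z x2))).
      by rewrite -[X in _ = X + _]e2; ring.
    by rewrite w subrr !mulr0 addr0.
  by rewrite w.
case: bi => -[f11 f12 f13] [f21 f22 f23] [f31 f32 f33].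
apply/eqP/negPn/negP => z32.
have shifted a b : (f1 - a *: f3) (Z (x3 + a *: x1 + b *: x2)) = 0.
  have [|||_ /eqP] := key (x3 + a *: x1 + b *: x2) (f1 - a *: f3) (f2 - b *: f3).
  - split; split; rewrite ?dualE_B ?dualE_Z ?dual_D ?dual_Z ?f11 ?f12 ?f13 ?f21 ?f22
      ?f23 ?f31 ?f32 ?f33; ring.
  - by rewrite dualE_B dualE_Z z11 z31; ring.
  - by rewrite dualE_B dualE_Z z21 z31; ring.
  by rewrite mulf_eq0 (negPf z32) orbF => /eqP.
have exp a b : f1 (Z x3) + b * f1 (Z x2) - a * f3 (Z x3) - a * b * f3 (Z x2) = 0.
  rewrite -[RHS](shifted a b) dualE_B dualE_Z !(lop_D _ _ lZ) !(lop_Z _ _ lZ).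
  by rewrite !dual_D !dual_Z z11 z31; ring.
(* The mixed second difference in a and b isolates the coefficient f3 (Z x2) of a b. *)
have e00 := exp 0 0; have e10 := exp 1 0; have e01 := exp 0 1; have e11 := exp 1 1.
move/eqP: z32; apply.
have -> : f3 (Z x2) =
  (f1 (Z x3) + 1 * f1 (Z x2) - 0 * f3 (Z x3) - 0 * 1 * f3 (Z x2)) +
  (f1 (Z x3) + 0 * f1 (Z x2) - 1 * f3 (Z x3) - 1 * 0 * f3 (Z x2)) -
  (f1 (Z x3) + 0 * f1 (Z x2) - 0 * f3 (Z x3) - 0 * 0 * f3 (Z x2)) -
  (f1 (Z x3) + 1 * f1 (Z x2) - 1 * f3 (Z x3) - 1 * 1 * f3 (Z x2)) by ring.
by rewrite e00 e10 e01 e11; ring.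
Qed.

(** If x and Z x are independent, testing on this pair shows that every f1 with f1 x = 1 and f1 (Z
    x) = 0 kills Z (Z x). A suitable f1 excludes any component of Z (Z x) off the line of Z x. *)
Lemma minor2_square Z x : is_linear_op Z -> minor2 Z -> exists c, Z (Z x) = c *: Z x.
Proof.
move=> lZ m2; have [[c xc]|/forallNP nx] := pselect (exists c, Z x = c *: x).
  by exists c; rewrite {1}xc lop_Z.
have x0 : x != 0.
  by apply/eqP => x0; apply: (nx 0); rewrite x0 lop_0// scaler0.
have [a [b [ax ay bx by_]]] := dual2 x0 nx.
suff : exists f1, [/\ f1 x = 1, f1 (Z x) = 0 &
    f1 (Z (Z x)) = 0 -> exists c, Z (Z x) = c *: Z x].
  move=> [f1 [f1x f1y]]; apply.
  by have := m2 x (Z x) f1 b; rewrite f1x f1y bx by_ mulr1 mul0r => ->.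
have [[c [d zcd]]|nz] := pselect (exists c d, Z (Z x) = c *: x + d *: Z x).
  exists a; split=> //; rewrite zcd dual_D !dual_Z ax ay mulr1 mulr0 addr0 => ->.
  by exists d; rewrite scale0r add0r.
have [|a' [b' [c' [[a1 a2 a3] _ [c1 c2 c3]]]]] := dual3 (w := Z (Z x)) (And4 ax ay bx by_).
  by move=> c d e; apply: nz; exists c, d.
exists (a' + c'); rewrite !dualE_D a1 a2 a3 c1 c2 c3 !add0r addr0; split=> // /eqP.
by rewrite oner_eq0.
Qed.

(** If x, Z x, Z (Z x) are independent, [minor3_col] applied to them says f3 (Z (Z x)) = 0, yet f3
    is dual to that vector. If they span a plane, there is no third test vector of this orbit, and
    the rank of Z^m is used instead. *)
Lemma minor3_square r s m Z x : r != s -> is_linear_op Z -> minor3 r s Z ->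
  rank1 (iter m Z) -> exists c, Z (Z x) = c *: Z x.
Proof.
move=> rs lZ m3 [w [g Zm]].
have [[c xc]|/forallNP nx] := pselect (exists c, Z x = c *: x).
  by exists c; rewrite {1}xc lop_Z.
have x0 : x != 0.
  by apply/eqP => x0; apply: (nx 0); rewrite x0 lop_0// scaler0.
have [a [b [ax ay bx by_]]] := dual2 x0 nx.
have [[c [d zcd]]|nz] := pselect (exists c d, Z (Z x) = c *: x + d *: Z x); last first.
  have [|f1 [f2 [f3 bi]]] := dual3 (w := Z (Z x)) (And4 ax ay bx by_).
    by move=> c d e; apply: nz; exists c, d.
  have := minor3_col rs lZ m3 bi; case: bi => -[_ -> _] [_ -> _] [_ -> ->].
  by move=> /(_ erefl erefl erefl)/eqP; rewrite oner_eq0.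
have [c0|c0] := eqVneq c 0; first by exists d; rewrite zcd c0 scale0r add0r.
(* Otherwise Z is injective on the invariant plane spanned by x and Z x. *)
pose V n p q := exists p' q', iter n Z (p *: x + q *: Z x) = p' *: x + q' *: Z x /\
  (p' = 0 -> q' = 0 -> p = 0 /\ q = 0).
have inj n p q : V n p q.
  elim: n => [|n [p' [q' [e nz]]]]; first by exists p, q.
  exists (q' * c), (p' + q' * d); split.
    rewrite iterS e (lop_D _ _ lZ) !(lop_Z _ _ lZ) zcd scalerDr !scalerA.
    by rewrite scalerDl addrCA.
  move=> /eqP; rewrite mulf_eq0 (negPf c0) orbF => /eqP q0.
  by rewrite q0 mul0r addr0 => p0; apply: nz.
have ker p q : p * g x + q * g (Z x) = 0 -> p = 0 /\ q = 0.
  move=> pq; have [p' [q' [e nz]]] := inj m p q.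
  have e0 : p' *: x + q' *: Z x = 0.
    by rewrite -e Zm /tens dual_D !dual_Z pq scale0r.
  apply: nz; [have := congr1 a e0|have := congr1 b e0];
    by rewrite dual_D !dual_Z ?ax ?ay ?bx ?by_ dual_0 ?mulr0 ?mulr1 ?addr0 ?add0r.
(* This combination of x and Z x is killed by g, so both coefficients vanish; then g kills x itself,
   contradicting injectivity of Z^m on the plane. *)
have [|gy gx] := ker (g (Z x)) (- g x); first by ring.
have [|/eqP] := ker 1 0; last by rewrite oner_eq0.
by move/eqP: gx; rewrite oppr_eq0 => /eqP ->; ring.
Qed.

(** If g2, g4 are dual to Z x, Z y, then g2 o Z and g4 o Z are dual to x, y and kill Z x, Z y. They
    serve to correct g2 and g4 on x and y. *)
Lemma square_zero_dual Z x y : bounded_op Z -> Z (Z x) = 0 -> Z (Z y) = 0 ->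
  Z x != 0 -> (forall c, Z y <> c *: Z x) -> exists f1 f2 f4 : dual E,
  [/\ [/\ f1 x = 1, f1 (Z x) = 0, f1 y = 0 & f1 (Z y) = 0],
      [/\ f2 x = 0, f2 (Z x) = 1, f2 y = 0 & f2 (Z y) = 0] &
      [/\ f4 x = 0, f4 (Z x) = 0, f4 y = 0 & f4 (Z y) = 1]].
Proof.
move=> bZ Zx Zy x0 nxy; have [g2 [g4 [g2x g2y g4x g4y]]] := dual2 x0 nxy.
pose f1 := dual_comp g2 bZ; pose f3 := dual_comp g4 bZ.
have f1E z : f1 z = g2 (Z z) by []. have f3E z : f3 z = g4 (Z z) by [].
exists f1, (g2 - g2 x *: f1 - g2 y *: f3), (g4 - g4 x *: f1 - g4 y *: f3).
by split; split; rewrite ?dualE_B ?dualE_Z ?f1E ?f3E ?Zx ?Zy ?g2x ?g2y ?g4x ?g4y ?dual_0;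
  ring.
Qed.

(** If Z x and Z y are independent, comparing x, y and x + y shows that their constants c agree. For
    c <> 0 both are eigenvectors of Z^m, which would have rank two; c = 0 is the square-zero
    configuration that the last hypothesis excludes. *)
Lemma rank1_of_square m Z : (0 < m)%N -> bounded_op Z -> rank1 (iter m Z) ->
  (forall x, exists c, Z (Z x) = c *: Z x) ->
  (forall x y f1 f2 f4, Z (Z x) = 0 -> Z (Z y) = 0 ->
     [/\ f1 x = 1, f1 (Z x) = 0, f1 y = 0 & f1 (Z y) = 0] ->
     [/\ f2 x = 0, f2 (Z x) = 1, f2 y = 0 & f2 (Z y) = 0] ->
     [/\ f4 x = 0, f4 (Z x) = 0, f4 y = 0 & f4 (Z y) = 1] -> False) ->
  rank1 Z.
Proof.
move=> m0 bZ [w [g Zm]] sq nsq; have [lZ _] := bZ.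
have [Z0|] := pselect (forall x, Z x = 0).
  by exists 0, 0; apply/funext => z; rewrite Z0 /tens scaler0.
move=> /existsNP[x /eqP Zx].
have [prop|] := pselect (forall y, exists c, Z y = c *: Z x).
  have [f fx] := dual_sep Zx.
  exists (Z x), (dual_comp f bZ); apply/funext => y; rewrite /tens /=.
  by have [c ->] := prop y; rewrite dual_Z fx mulr1.
move=> /existsNP[y /forallNP nxy]; exfalso.
have [a [b [ax ay bx by_]]] := dual2 Zx nxy.
have [c xc] := sq x; have [d yd] := sq y; have [e xye] := sq (x + y).
have ec : e = c.
  have := congr1 a xye.
  by rewrite !(lop_D _ _ lZ) xc yd dual_D !dual_Z dual_D ax ay addr0 !mulr1 mulr0 addr0.
have ed : e = d.
  have := congr1 b xye.
  by rewrite !(lop_D _ _ lZ) xc yd dual_D !dual_Z dual_D bx by_ add0r !mulr1 mulr0 add0r.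
have [c0|c0] := eqVneq c 0.
  have Zx0 : Z (Z x) = 0 by rewrite xc c0 scale0r.
  have Zy0 : Z (Z y) = 0 by rewrite yd -ed ec c0 scale0r.
  have [f1 [f2 [f4 [h1 h2 h4]]]] := square_zero_dual bZ Zx0 Zy0 Zx nxy.
  exact: (nsq x y f1 f2 f4).
have iz z : Z (Z z) = c *: Z z -> iter m Z (Z z) = c ^+ m *: Z z.
  move=> e1; elim: (m) => [|k IH]; first by rewrite scale1r.
  by rewrite iterS IH (lop_Z _ _ lZ) e1 scalerA exprSr.
have cm : c ^+ m != 0 by rewrite expf_neq0.
have Ex := iz x xc; have Ey := iz y (etrans yd (congr1 (fun t => t *: _) (etrans (esym ed) ec))).
rewrite Zm /tens in Ex Ey.
have gx : g (Z x) != 0.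
  apply/eqP => g0; move: Ex; rewrite g0 scale0r => /esym/eqP.
  by rewrite scaler_eq0 (negPf cm) (negPf Zx).
apply: (nxy (g (Z y) / g (Z x))); apply: (scalerI cm).
rewrite -Ey scalerA [_ * (_ / _)]mulrC -scalerA -Ex scalerA divfK//.
Qed.

Theorem minor2_rank1 m Z : (0 < m)%N -> bounded_op Z -> rank1 (iter m Z) -> minor2 Z ->
  rank1 Z.
Proof.
move=> m0 bZ Zm m2; have [lZ _] := bZ.
apply: (rank1_of_square m0 bZ Zm) => [x|]; first exact: minor2_square.
move=> x y f1 f2 f4 Zx Zy [a1 a2 a3 a4] [b1 b2 b3 b4] [c1 c2 c3 c4].
(* On the biorthogonal pair x, Z x + y the matrix of Z is the swap (0 1; 1 0), of determinant -1. *)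
have := m2 x (Z x + y) (f1 + f4) f2.
rewrite (lop_D _ _ lZ) Zx add0r !dualE_D !dual_D a1 a2 a3 a4 b1 b2 b3 b4 c1 c2 c3 c4.
rewrite !addr0 !add0r mul0r mulr1 => /(_ (And4 erefl erefl erefl erefl)) /esym/eqP.
by rewrite oner_eq0.
Qed.

Theorem minor3_rank1 r s m Z : r != s -> (0 < m)%N -> bounded_op Z ->
  rank1 (iter m Z) -> minor3 r s Z -> rank1 Z.
Proof.
move=> rs m0 bZ Zm m3; have [lZ _] := bZ.
apply: (rank1_of_square m0 bZ Zm) => [x|]; first exact: (minor3_square x rs lZ m3 Zm).
move=> x y f1 f2 f4 Zx Zy [a1 a2 a3 a4] [b1 b2 b3 b4] [c1 c2 c3 c4].
(* For this triple [minor3_col] would give f4 (Z (Z x + y)) = f4 (Z y) = 0, but this value is 1. *)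
have := @minor3_col r s Z x (Z x + y) (Z y) f1 f2 f4 rs lZ m3.
rewrite (lop_D _ _ lZ) Zx add0r c4 => H; suff /eqP : 1 = 0 :> R[i] by rewrite oner_eq0.
by apply: H => //; split; split; rewrite ?dual_D ?a1 ?a2 ?a3 ?a4 ?b1 ?b2 ?b3 ?b4 ?c1 ?c2 ?c3 ?c4
  ?addr0 ?add0r.
Qed.

End Minors.

(** * From multiplicative identities to trace identities *)

Section TracePreserving.
Variables (R : realType) (E : normedModType R[i]).
Variables (A : set (E -> E)) (hA : standard_operator_algebra A).
Variables (phi : (E -> E) -> E -> E) (phiA : forall a, A a -> A (phi a)).
Implicit Types (T B Z a b : E -> E) (u v w x y z : E) (f g h k : dual E).

(* What remains of the hypothesis after taking traces: tr (phi a * phi b ^ n) = tr (a * b ^ n)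
   when a or b has rank one. *)
Definition trace_preserving n := [/\
  (forall a, A a -> rank1 a -> rank1 (phi a)),
  (forall b x f u h, A b -> phi (tens x f) = tens u h ->
     h (iter n (phi b) u) = f (iter n b x)) &
  (forall a x f u h, A a -> phi (tens x f) = tens u h ->
     h u ^+ n.-1 * h (phi a u) = f x ^+ n.-1 * f (a x))].

Lemma iter_word r s a : iter r a \o a \o iter s a = iter (r + s).+1 a.
Proof. by apply/funext => z; rewrite -addnS iterD iterS. Qed.

Lemma rank_le_S T n : rank_le T n -> rank_le T n.+1.
Proof.
move=> [ys H]; exists (fun i => if unlift ord0 i is Some j then ys j else 0) => x.
have [c cE] := H x.
exists (fun i => if unlift ord0 i is Some j then c j else 0).
rewrite big_ord_recl unlift_none scale0r add0r cE.
by apply: eq_bigr => i _; rewrite liftK.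
Qed.

Section Product.
Variables r s : nat.
Hypothesis rs0 : (0 < r + s)%N.
Hypothesis surj : forall T, bounded_op T -> rank_le T 2 -> exists2 a, A a & phi a = T.
Hypothesis word : forall a b, A a -> A b -> rank1 a \/ rank1 b ->
  exists th, jordan_automorphism A th /\
    iter r (phi b) \o phi a \o iter s (phi b) = th (iter r b \o a \o iter s b).

Lemma product_trace_preserving : trace_preserving (r + s).
Proof.
have tA := A_tens hA; have bA := A_bounded hA.
split.
- move=> _ /[swap] [[x [f ->]]] At; have AZ := phiA At; have bZ := bA _ AZ.
  apply: (@minor2_rank1 _ _ (r + s).+1) => //.
    have [|th [jth]] := word At At; first by left; exists x, f.
    rewrite !iter_word => ->; rewrite -iter_word.
    have [y [g [-> _]]] := word_rank1_mid r s x f (tens_bounded x f).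
    by have [y' [g' [-> _]]] := jth_tens hA jth y g; exists y', g'.
  apply: (@minor2_words _ _ r s); first by case: bZ.
  move=> B bB /(surj bB)[b Ab <-].
  have [|th [jth ->]] := word At Ab; first by left; exists x, f.
  have [y [g [-> _]]] := word_rank1_mid r s x f (bA _ Ab).
  by have [y' [g' [-> _]]] := jth_tens hA jth y g; exists y', g'.
- move=> b x f u h Ab e.
  have [|th [jth]] := word (tA x f) Ab; first by left; exists x, f.
  have [y [g [-> <-]]] := word_rank1_mid r s x f (bA _ Ab).
  have [y' [g' [-> <-]]] := jth_tens hA jth y g.
  rewrite e; have [z [k [-> <-]]] := word_rank1_mid r s u h (bA _ (phiA Ab)).
  exact: tens_trace.
- move=> a x f u h Aa e.
  have [|th [jth]] := word Aa (tA x f); first by right; exists x, f.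
  have [y [g [-> <-]]] := word_rank1_ends x f (bA _ Aa) rs0.
  have [y' [g' [-> <-]]] := jth_tens hA jth y g.
  rewrite e; have [z [k [-> <-]]] := word_rank1_ends u h (bA _ (phiA Aa)) rs0.
  exact: tens_trace.
Qed.

End Product.

Section JordanProduct.
Variables r s : nat.
Hypothesis rs0 : (0 < r + s)%N.
Hypothesis surj : forall T, bounded_op T -> rank_le T 3 -> exists2 a, A a & phi a = T.
Hypothesis word : forall a b, A a -> A b -> rank1 a \/ rank1 b ->
  exists th, jordan_automorphism A th /\
    (iter r (phi b) \o phi a \o iter s (phi b)) +
    (iter s (phi b) \o phi a \o iter r (phi b)) =
    th ((iter r b \o a \o iter s b) + (iter s b \o a \o iter r b)).

Lemma double_word th X Y : jordan_automorphism A th -> A Y -> X + X = th (Y + Y) ->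
  X = th Y.
Proof.
have dbl (T : E -> E) : T + T = 2 *: T by rewrite scaler_nat mulr2n.
move=> jth AY; rewrite (jth_D jth)// (dbl X) (dbl (th Y)).
by apply: scalerI; rewrite pnatr_eq0.
Qed.

Lemma jordan_trace_preserving : trace_preserving (r + s).
Proof.
have tA := A_tens hA; have bA := A_bounded hA.
(* For r = s the argument with eigenvalues 1 and 2 degenerates, but the Jordan word is then twice an
   ordinary one. *)
have [ers|rs] := eqVneq r s.
  apply: product_trace_preserving => //.
    by move=> T bT /rank_le_S; exact: surj.
  move=> a b Aa Ab rk; have [th [jth]] := word Aa Ab rk; rewrite -ers => e.
  exists th; split=> //; apply: double_word => //; exact: (A_word hA).
have sum2 th y g y2 g2 : jordan_automorphism A th -> exists v k v2 k2,
    [/\ th (tens y g + tens y2 g2) = tens v k + tens v2 k2, k v = g y & k2 v2 = g2 y2].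
  move=> jth; rewrite (jth_D jth)//.
  have [v [k [-> kv]]] := jth_tens hA jth y g.
  have [v2 [k2 [-> kv2]]] := jth_tens hA jth y2 g2.
  by exists v, k, v2, k2.
(* The traces of the two summands of a Jordan word depend only on r + s, so they coincide and the
   identity can be halved. *)
have half (p q : R[i]) : p + p = q + q -> p = q.
  have dbl (t : R[i]) : t + t = 2 * t by ring.
  by rewrite (dbl p) (dbl q); apply: mulfI; rewrite pnatr_eq0.
split.
- move=> _ /[swap] [[x [f ->]]] At; have AZ := phiA At; have bZ := bA _ AZ.
  apply: (@minor3_rank1 _ _ r s (r + s).+1) => //.
    have [|th [jth]] := word At At; first by left; exists x, f.
    rewrite !iter_word [(s + r)%N]addnC => /(double_word jth) ->; last first.
      by rewrite -iter_word; exact: (A_word hA).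
    rewrite -iter_word.
    have [y [g [-> _]]] := word_rank1_mid r s x f (tens_bounded x f).
    by have [y' [g' [-> _]]] := jth_tens hA jth y g; exists y', g'.
  apply: minor3_words; first by case: bZ.
  move=> B bB /(surj bB)[b Ab <-].
  have [|th [jth ->]] := word At Ab; first by left; exists x, f.
  have [y [g [-> _]]] := word_rank1_mid r s x f (bA _ Ab).
  have [y2 [g2 [-> _]]] := word_rank1_mid s r x f (bA _ Ab).
  by have [v [k [v2 [k2 [-> _ _]]]]] := sum2 th y g y2 g2 jth; exists v, k, v2, k2.
- move=> b x f u h Ab e.
  have [|th [jth]] := word (tA x f) Ab; first by left; exists x, f.
  have [y [g [-> gy]]] := word_rank1_mid r s x f (bA _ Ab).
  have [y2 [g2 [-> gy2]]] := word_rank1_mid s r x f (bA _ Ab).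
  have [v [k [v2 [k2 [-> kv kv2]]]]] := sum2 th y g y2 g2 jth.
  rewrite e; have [z [l [-> lz]]] := word_rank1_mid r s u h (bA _ (phiA Ab)).
  have [z2 [l2 [-> lz2]]] := word_rank1_mid s r u h (bA _ (phiA Ab)).
  move=> /tens2_trace; rewrite lz lz2 kv kv2 gy gy2 [(s + r)%N]addnC; exact: half.
- move=> a x f u h Aa e; have sr0 : (0 < s + r)%N by rewrite addnC.
  have [|th [jth]] := word Aa (tA x f); first by right; exists x, f.
  have [y [g [-> gy]]] := word_rank1_ends x f (bA _ Aa) rs0.
  have [y2 [g2 [-> gy2]]] := word_rank1_ends x f (bA _ Aa) sr0.
  have [v [k [v2 [k2 [-> kv kv2]]]]] := sum2 th y g y2 g2 jth.
  rewrite e; have [z [l [-> lz]]] := word_rank1_ends u h (bA _ (phiA Aa)) rs0.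
  have [z2 [l2 [-> lz2]]] := word_rank1_ends u h (bA _ (phiA Aa)) sr0.
  move=> /tens2_trace; rewrite lz lz2 kv kv2 gy gy2 [(s + r)%N]addnC; exact: half.
Qed.

End JordanProduct.
End TracePreserving.

Section GeneralizedProducts.
Variables (R : realType) (E : normedModType R[i]).
Variables (A : set (E -> E)) (hA : standard_operator_algebra A).
Variables (phi : (E -> E) -> E -> E) (phiA : forall a, A a -> A (phi a)).
Variables (k : nat) (idx : seq 'I_k).
Hypotheses (k2 : (2 <= k)%N) (idx_all : forall i : 'I_k, i \in idx).

Lemma other_index (p : 'I_k) : exists q : 'I_k, q != p.
Proof.
case: p => -[|i] ip.
  by exists (Ordinal k2); rewrite -val_eqE.
by exists (Ordinal (ltnW k2)); rewrite -val_eqE.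
Qed.

(** Positivity of the number of other letters comes from k >= 2: some index besides p has to occur
    in the sequence. *)
Lemma idx_split p : count_mem p idx = 1%N -> exists s t,
  [/\ idx = s ++ p :: t, p \notin s, p \notin t, size idx = (size s + size t).+1 &
      (0 < size s + size t)%N].
Proof.
move=> /split_once[s [t [e ps pt]]]; exists s, t.
have sz : size idx = (size s + size t).+1 by rewrite e size_cat /= addnS.
split=> //; rewrite lt0n addn_eq0; apply/negP => /andP[/nilP s0 /nilP t0].
have [q qp] := other_index p.
by have := idx_all q; rewrite e s0 t0 /= inE (negPf qp).
Qed.

Lemma exists_rank1 p a b : A a -> A b -> rank1 a \/ rank1 b ->
  exists j : 'I_k, rank_le (if j == p then a else b) 1.
Proof.
move=> /(A_bounded hA) ba /(A_bounded hA) bb [ra|rb].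
  by exists p; rewrite eqxx; apply/rank_le1P.
have [q qp] := other_index p.
by exists q; rewrite (negPf qp); apply/rank_le1P.
Qed.

Lemma gen_trace_preserving : (exists p : 'I_k, count_mem p idx = 1%N) ->
  ( ( (forall T, bounded_op T -> rank_le T 2 -> exists2 a, A a & phi a = T) /\
      (forall a : 'I_k -> E -> E, (forall j, A (a j)) -> (exists j, rank_le (a j) 1) ->
         exists th, algebra_automorphism A th /\
           gen_prod idx (fun j => phi (a j)) = th (gen_prod idx a)) )
    \/
    ( (forall T, bounded_op T -> rank_le T 3 -> exists2 a, A a & phi a = T) /\
      (forall a : 'I_k -> E -> E, (forall j, A (a j)) -> (exists j, rank_le (a j) 1) ->
         exists th, jordan_automorphism A th /\
           gen_jordan idx (fun j => phi (a j)) = th (gen_jordan idx a)) ) ) ->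
  exists n, [/\ (0 < n)%N, size idx = n.+1, trace_preserving A phi n &
    forall T, bounded_op T -> rank_le T 2 -> exists2 a, A a & phi a = T].
Proof.
move=> [p /idx_split[s [t [e ps pt sz st0]]]] hyp; exists (size s + size t)%N.
pose c (a b : E -> E) (j : 'I_k) := if j == p then a else b.
have cP a b : c a b p = a by rewrite /c eqxx.
have cN a b i : i != p -> c a b i = b by rewrite /c => /negPf ->.
have cA a b j : A a -> A b -> A (c a b j) by rewrite /c; case: eqP.
have w1 (T : 'I_k -> E -> E) b : (forall i, i != p -> T i = b) ->
    gen_prod idx T = iter (size s) b \o T p \o iter (size t) b.
  by rewrite e; exact: gen_prod_word.
have w2 (T : 'I_k -> E -> E) b : (forall i, i != p -> T i = b) ->
    gen_prod (rev idx) T = iter (size t) b \o T p \o iter (size s) b.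
  rewrite e rev_cat rev_cons -cats1 -catA /= -(size_rev t) -(size_rev s).
  by apply: gen_prod_word; rewrite mem_rev.
case: hyp => -[surj word]; split=> //.
- apply: product_trace_preserving => // a b Aa Ab rk.
  have [||th [ath]] := word (c a b); [by move=> j; exact: cA|exact: exists_rank1|].
  have cphi i : i != p -> phi (c a b i) = phi b by move=> ip; rewrite cN.
  rewrite (w1 _ _ cphi) (w1 _ b); last by move=> i; exact: cN.
  by rewrite cP => ->; exists th; split=> //; exact: algebra_jordan.
- apply: jordan_trace_preserving => // a b Aa Ab rk.
  have [||th [jth]] := word (c a b); [by move=> j; exact: cA|exact: exists_rank1|].
  have cphi i : i != p -> phi (c a b i) = phi b by move=> ip; rewrite cN.
  rewrite /gen_jordan (w1 _ _ cphi) (w2 _ _ cphi).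
  rewrite (w1 _ b); last by move=> i; exact: cN.
  rewrite (w2 _ b); last by move=> i; exact: cN.
  by rewrite cP => eq; exists th; split.
- by move=> T bT /rank_le_S; exact: surj.
Qed.

End GeneralizedProducts.

(** * Structure of trace preserving maps *)

Section BothNonzero.
Variables (R : realType) (E : normedModType R[i]).

Lemma dual_both_neq0 (x y : E) : x != 0 -> y != 0 ->
  exists f : dual E, f x != 0 /\ f y != 0.
Proof.
move=> /dual_sep[a ax] /dual_sep[b by_].
have [ay|ay] := eqVneq (a y) 0; last by exists a; rewrite ax oner_eq0.
have [bx|bx] := eqVneq (b x) 0; last by exists b; rewrite by_ oner_eq0.
by exists (a + b); rewrite !dualE_D ax ay bx by_ addr0 add0r !oner_eq0.
Qed.

Lemma both_dual_neq0 (f g : dual E) : f != 0 -> g != 0 ->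
  exists x, f x != 0 /\ g x != 0.
Proof.
move=> /dual_neq0[x fx] /dual_neq0[y gy].
have [gx|gx] := eqVneq (g x) 0; last by exists x; rewrite fx oner_eq0.
have [fy|fy] := eqVneq (f y) 0; last by exists y; rewrite gy oner_eq0.
by exists (x + y); rewrite !dual_D fx fy gx gy addr0 add0r !oner_eq0.
Qed.

End BothNonzero.

Section WeakBounded.
Variables (R : realType) (E : completeNormedModType R[i]).

(** The family k o S, for k in the dual unit ball, is pointwise bounded by |S x|; norming
    functionals turn its uniform bound into one for S. *)
Lemma weakly_bounded (S : E -> E) : is_linear_op S ->
  (forall k : dual E, dual_elem (k \o S)) -> bounded_op S.
Proof.
move=> lS kS.
have [] := @uniform_boundedness R E (@nr R E) {k : dual E | forall y, nr (k y) <= nr y}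
  (fun k x => nr (sval k (S x))).
- exact: nr_ge0.
- exact: nrN.
- by move=> r x r0; rewrite nrZ nr_real// ltW.
- exact: nr_geometric_complete.
- by move=> k x y; rewrite (lop_D _ _ lS) dual_D nrD.
- by move=> k x; rewrite -scaleN1r (lop_Z _ _ lS) dual_Z mulN1r nrN.
- by move=> k r x r0; rewrite (lop_Z _ _ lS) dual_Z nrM nr_real// ltW.
- by move=> [k k1]; have /dual_elemP[_ [C _ kC]] := kS k; exists C.
- by move=> x; exists (nr (S x)) => -[k k1] /=; exact: k1.
move=> M MS; apply/bounded_opP; split=> //; exists `|M| => // x.
have [k [k1 kx]] := norming_dual (S x).
rewrite -kx; apply: le_trans (MS (exist _ k k1) x) _.
by rewrite ler_wpM2r ?nr_ge0// ler_norm.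
Qed.

End WeakBounded.

Section Structure.
Variables (R : realType) (E : completeNormedModType R[i]).
Variables (A : set (E -> E)) (hA : standard_operator_algebra A).
Variables (phi : (E -> E) -> E -> E) (phiA : forall a, A a -> A (phi a)).
Variable n : nat.
Hypothesis n0 : (0 < n)%N.
Hypothesis phi_tp : trace_preserving A phi n.
Hypothesis surj : forall T, bounded_op T -> rank_le T 2 -> exists2 a, A a & phi a = T.
Implicit Types (T B Z a b : E -> E) (u v w x y z : E) (f g h k : dual E).

Let phi_rank1 x f : exists u h, phi (tens x f) = tens u h.
Proof. by case: phi_tp => H _ _; apply: H; [exact: A_tens|exists x, f]. Qed.

Let phi_tr b x f u h : A b -> phi (tens x f) = tens u h ->
  h (iter n (phi b) u) = f (iter n b x).
Proof. by case: phi_tp => _ H _; exact: H. Qed.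

Let phi_tr' a x f u h : A a -> phi (tens x f) = tens u h ->
  h u ^+ n.-1 * h (phi a u) = f x ^+ n.-1 * f (a x).
Proof. by case: phi_tp => _ _ H; exact: H. Qed.

Let iter_tens_n u h z : iter n (tens u h) z = (h u ^+ n.-1 * h z) *: u.
Proof. by rewrite -{1}(prednK n0) iter_tens. Qed.

Lemma phi_onto_tens v k : exists2 b, A b & phi b = tens v k.
Proof.
apply: surj; first exact: tens_bounded.
by apply/rank_le_S/rank_le1P; [exact: tens_bounded|exists v, k].
Qed.

(** Pairs with k v = 1 are those where v (x) k is idempotent. Any other k becomes such a functional
    after adding a multiple of some k0 with k0 v = 1. *)
Lemma eq_op_test T1 T2 : is_linear_op T1 -> is_linear_op T2 ->
  (forall v k, k v = 1 -> k (T1 v) = k (T2 v)) -> T1 = T2.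
Proof.
move=> l1 l2 H; apply/funext => v; apply: dual_inj => k.
have [->|/dual_sep[k0 k0v]] := eqVneq v 0; first by rewrite !lop_0.
have := H v (k + (1 - k v) *: k0); rewrite !dualE_D !dualE_Z k0v (H v k0 k0v).
move=> H'; apply: (addIr ((1 - k v) * k0 (T2 v))); apply: H'; ring.
Qed.

(** The operator b depends on v and k only, so the right-hand side is linear in x and in f: this
    yields the linearity of phi on rank-one operators. *)
Lemma phi_test v k : k v = 1 -> exists2 b, A b &
  forall x f, k (phi (tens x f) v) = f (iter n b x).
Proof.
move=> kv; have [b Ab bE] := phi_onto_tens v k; exists b => // x f.
have [u [h e]] := phi_rank1 x f.
rewrite -(phi_tr Ab e) bE iter_tens_n kv expr1n mul1r !dual_Z e /tens.
by rewrite dual_Z mulrC.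
Qed.

Let lphi x f : is_linear_op (phi (tens x f)).
Proof. exact/(A_linear hA)/phiA/(A_tens hA). Qed.

Let llin c x f y g : is_linear_op (c *: phi (tens x f) + phi (tens y g)).
Proof. by apply/(A_linear hA)/(A_add hA); [apply: (A_scale hA)|]; exact/phiA/(A_tens hA). Qed.

Lemma phi_linl c x y f :
  phi (tens (c *: x + y) f) = c *: phi (tens x f) + phi (tens y f).
Proof.
apply: eq_op_test => // v k kv; have [b Ab bE] := phi_test kv.
have -> : (c *: phi (tens x f) + phi (tens y f)) v =
  c *: phi (tens x f) v + phi (tens y f) v by [].
have [lb _] := bounded_iter n (A_bounded hA Ab).
by rewrite dual_D dual_Z !bE (lop_D _ _ lb) (lop_Z _ _ lb) dual_D dual_Z.
Qed.

Lemma phi_linr c x f g :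
  phi (tens x (c *: f + g)) = c *: phi (tens x f) + phi (tens x g).
Proof.
apply: eq_op_test => // v k kv; have [b Ab bE] := phi_test kv.
have -> : (c *: phi (tens x f) + phi (tens x g)) v =
  c *: phi (tens x f) v + phi (tens x g) v by [].
by rewrite dual_D dual_Z !bE.
Qed.

Lemma phi_Dl x y f : phi (tens (x + y) f) = phi (tens x f) + phi (tens y f).
Proof. by rewrite -[x]scale1r phi_linl !scale1r. Qed.

Lemma phi_Dr x f g : phi (tens x (f + g)) = phi (tens x f) + phi (tens x g).
Proof. by rewrite -[f]scale1r phi_linr !scale1r. Qed.

Lemma phi_tens0 : phi (tens 0 0) = 0.
Proof. by apply: (addrI (phi (tens 0 0))); rewrite -phi_Dl !addr0. Qed.

Let tens0l f : tens 0 f = tens 0 0 :> (E -> E).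
Proof. by apply/funext => z; rewrite /tens !scaler0. Qed.

Let tens0r x : tens x 0 = tens 0 0 :> (E -> E).
Proof. by apply/funext => z; rewrite /tens !scale0r. Qed.

Lemma phi_Zl c x f : phi (tens (c *: x) f) = c *: phi (tens x f).
Proof. by rewrite -[c *: x]addr0 phi_linl tens0l phi_tens0 addr0. Qed.

Lemma phi_Zr c x f : phi (tens x (c *: f)) = c *: phi (tens x f).
Proof. by rewrite -[c *: f]addr0 phi_linr tens0r phi_tens0 addr0. Qed.

Lemma phi_0 : phi 0 = 0.
Proof. by rewrite -[in LHS](@tens0 R E) phi_tens0. Qed.

Lemma phi_eq0 x f : phi (tens x f) = 0 -> x = 0 \/ f = 0.
Proof.
move=> e; have [->|x0] := eqVneq x 0; first by left.
have [->|f0] := eqVneq f 0; first by right.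
have [y fy] := dual_neq0 f0.
have y0 : y != 0 by apply: contra_eq_neq fy => ->; rewrite dual_0 eq_sym oner_neq0.
(* With f y = 1, the trace of (x (x) f) (y (x) g)^n is g(y)^(n-1) g(x), nonzero by this choice of
   g. *)
have [g [gx gy]] := dual_both_neq0 x0 y0.
have := phi_tr (A_tens hA y g) (etrans e (esym (@tens0 R E))).
rewrite dualE_0 iter_tens_n dual_Z fy mulr1 => /esym/eqP.
by rewrite mulf_eq0 (negPf gx) orbF expf_eq0 (negPf gy) andbF.
Qed.

Section Base.
Variables (x0 : E) (f0 : dual E) (u0 : E) (h0 : dual E).
Hypotheses (f0x0 : f0 x0 = 1) (phi_e : phi (tens x0 f0) = tens u0 h0).

Let xi := h0 u0.

Lemma xi_root : xi ^+ n.+1 = 1.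
Proof.
have := phi_tr' (A_tens hA x0 f0) phi_e.
rewrite phi_e /tens !dual_Z f0x0 expr1n !mulr1 => <-.
by rewrite -{1}(prednK n0) !exprS -/xi; ring.
Qed.

Lemma xi_neq0 : xi != 0.
Proof.
apply/eqP => x; have := xi_root; rewrite x expr0n /= => /eqP.
by rewrite eq_sym oner_eq0.
Qed.

(** By [xi_root], xi^2 is the inverse of xi^(n-1); this is the origin of the factor xi^2 in the
    identities that follow. *)
Lemma xi_cancel c d : xi ^+ n.-1 * c = d -> c = xi ^+ 2 * d.
Proof.
move=> <-; rewrite mulrA -exprD.
by have -> : (2 + n.-1 = n.+1)%N; rewrite ?xi_root ?mul1r// -(prednK n0).
Qed.

Lemma phi_cross x f u h : phi (tens x f) = tens u h ->
  h u0 * h0 u = xi ^+ 2 * (f x0 * f0 x).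
Proof.
move=> e; apply: xi_cancel.
have := phi_tr (A_tens hA x0 f0) e.
by rewrite phi_e !iter_tens_n !dual_Z f0x0 expr1n mul1r -/xi [f x0 * _]mulrC => <-; ring.
Qed.

Lemma phi_crossing x f u h v k : f0 x = 1 -> phi (tens x f0) = tens u h ->
  phi (tens x0 f) = tens v k -> h u ^+ n.-1 * (h v * k u) = f x.
Proof.
move=> fx e1 e2; have := phi_tr (A_tens hA x f0) e2.
by rewrite e1 !iter_tens_n !dual_Z fx f0x0 expr1n !mul1r mulrA.
Qed.

Let u00 : u0 != 0.
Proof. by apply: contraNneq xi_neq0 => u; rewrite /xi u dual_0. Qed.

Let h00 : h0 != 0.
Proof. by apply: contraNneq xi_neq0 => h; rewrite /xi h. Qed.

(** With all second factors equal to h0, the trace of phi(x0 (x) f) phi(x (x) f0)^n involves only h0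
    u and h0 v, which [phi_cross] determines. The outcome is f x = f x0 for every f, so E is a
    line. *)
Lemma mixed_l : (forall x, exists u, phi (tens x f0) = tens u h0) ->
  (forall f, exists u, phi (tens x0 f) = tens u h0) -> forall x, f0 x = 1 -> x = x0.
Proof.
move=> P Q x fx; apply: dual_inj => f.
have [u e1] := P x; have [v e2] := Q f.
rewrite -(phi_crossing fx e1 e2).
have c1 := phi_cross e1; have c2 := phi_cross e2.
rewrite f0x0 fx !mulr1 -/xi expr2 in c1.
rewrite f0x0 mulr1 -/xi expr2 -mulrA in c2.
rewrite (mulfI xi_neq0 c1) (mulfI xi_neq0 c2).
have -> : xi ^+ n.-1 * (xi * f x0 * xi) = xi ^+ n.-1.+2 * f x0 by rewrite !exprS; ring.
by rewrite prednK// xi_root mul1r.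
Qed.

Lemma mixed_r : (forall x, exists h, phi (tens x f0) = tens u0 h) ->
  (forall f, exists h, phi (tens x0 f) = tens u0 h) -> forall x, f0 x = 1 -> x = x0.
Proof.
move=> P Q x fx; apply: dual_inj => f.
have [h e1] := P x; have [k e2] := Q f.
rewrite -(phi_crossing fx e1 e2).
have c1 := phi_cross e1; have c2 := phi_cross e2.
rewrite f0x0 fx !mulr1 -/xi expr2 in c1.
rewrite f0x0 mulr1 -/xi expr2 -mulrA [xi * f x0]mulrC mulrA in c2.
rewrite (mulIf xi_neq0 c1) (mulIf xi_neq0 c2).
have -> : xi ^+ n.-1 * (xi * (xi * f x0)) = xi ^+ n.-1.+2 * f x0 by rewrite !exprS; ring.
by rewrite prednK// xi_root mul1r.
Qed.

Lemma dim1_dual : (forall x, f0 x = 1 -> x = x0) ->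
  (forall x, x = f0 x *: x0) /\ (forall f, f = f x0 *: f0).
Proof.
move=> d1; have xE x : x = f0 x *: x0.
  have := d1 (x - f0 x *: x0 + x0); rewrite dual_D dual_B dual_Z f0x0 mulr1 subrr add0r.
  by move=> /(_ erefl)/eqP; rewrite -subr_eq0 addrK subr_eq0 => /eqP.
by split=> // f; apply: dual_eq => x; rewrite dualE_Z {1}(xE x) dual_Z mulrC.
Qed.

Lemma phi_sides :
  ((forall x, exists u, phi (tens x f0) = tens u h0) /\
   (forall f, exists h, phi (tens x0 f) = tens u0 h)) \/
  ((forall x, exists h, phi (tens x f0) = tens u0 h) /\
   (forall f, exists u, phi (tens x0 f) = tens u h0)).
Proof.
have tt := tens_tensor_like E.
have [P|P] := rank1_line_dichotomy tt (L := fun x => phi (tens x f0)) (x0 := x0)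
  (fun x y => phi_Dl x y f0) (fun x => phi_rank1 x f0) phi_e u00 h00;
have [Q|Q] := rank1_line_dichotomy tt (L := fun f => phi (tens x0 f)) (x0 := f0)
  (fun f g => phi_Dr x0 f g) (fun f => phi_rank1 x0 f) phi_e u00 h00.
(* Mixed case: every f is a multiple of f0, so x0 (x) f is mapped to a multiple of u0 (x) h0 and the
   direct alternative holds as well. *)
- left; split=> // f; have [_ d] := dim1_dual (mixed_l P Q).
  by exists (f x0 *: h0); rewrite {1}(d f) phi_Zr phi_e (tZr tt).
- by left.
- by right.
- left; split=> // x; have [d _] := dim1_dual (mixed_r P Q).
  by exists (f0 x *: u0); rewrite {1}(d x) phi_Zl phi_e (tZl tt).
Qed.

Section Pairing.
(** Both factors may depend on x and on f, so that the direct form (u = S x, h = T f) and the dual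
    form (u = T f, h = S x) are treated at once. Only bilinearity of h x f (b (u x f)) is common to
    the two. *)
Variables (u : E -> dual E -> E) (h : E -> dual E -> dual E).
Hypotheses (phi_uh : forall x f, phi (tens x f) = tens (u x f) (h x f))
  (uh0 : u x0 f0 = u0 /\ h x0 f0 = h0)
  (lx : forall b, is_linear_op b -> forall f c x y,
    h (c *: x + y) f (b (u (c *: x + y) f)) = c * h x f (b (u x f)) + h y f (b (u y f)))
  (lf : forall b, is_linear_op b -> forall x c f g,
    h x (c *: f + g) (b (u x (c *: f + g))) = c * h x f (b (u x f)) + h x g (b (u x g))).

Let Zf b : is_linear_op b -> forall x c f, h x (c *: f) (b (u x (c *: f))) = c * h x f (b (u x f)).
Proof.
move=> lb x c f; have z : h x 0 (b (u x 0)) = 0.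
  apply: (addrI (h x 0 (b (u x 0)))); rewrite addr0.
  by have := lf lb x 1 0 0; rewrite scaler0 addr0 mul1r => <-.
by have := lf lb x c f 0; rewrite addr0 z addr0.
Qed.

(** The trace identity only gives t^(n+1) = (f x)^(n+1). But then the bilinear form t vanishes
    wherever f x does, hence is proportional to f x in each variable; a vector y with f y and f0 y
    nonzero links the factor to its value xi at (x0, f0). *)
Lemma pairing_id x f : h x f (u x f) = xi * f x.
Proof.
pose t x f := h x f (u x f); rewrite -/(t x f).
have lid : is_linear_op (fun z : E => z) by [].
have tx f' c x' y' : t (c *: x' + y') f' = c * t x' f' + t y' f' := lx lid f' c x' y'.
have tf x' c f' g' : t x' (c *: f' + g') = c * t x' f' + t x' g' := lf lid x' c f' g'.
have tn x' f' : t x' f' ^+ n.+1 = f' x' ^+ n.+1.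
  have := phi_tr' (A_tens hA x' f') (phi_uh x' f').
  rewrite phi_uh /tens !dual_Z -/(t x' f').
  by rewrite -!expr2 -!exprD addn2 prednK.
have t0 x' f' : f' x' = 0 -> t x' f' = 0.
  by move=> z; apply/eqP; have := tn x' f'; rewrite z expr0n /= => /eqP; rewrite expf_eq0.
have t1 x' y' f' : f' y' != 0 -> t x' f' = f' x' * (t y' f' / f' y').
  move=> fy; have := t0 (- (f' x' / f' y') *: y' + x') f'.
  rewrite dual_D dual_Z tx mulNr divfK// addNr => /(_ erefl)/eqP.
  by rewrite addrC mulNr subr_eq0 => /eqP ->; field.
have t2 x' f' g' : g' x' != 0 -> t x' f' = f' x' * (t x' g' / g' x').
  move=> fy; have := t0 x' (- (f' x' / g' x') *: g' + f').
  rewrite dualE_D dualE_Z tf mulNr divfK// addNr => /(_ erefl)/eqP.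
  by rewrite addrC mulNr subr_eq0 => /eqP ->; field.
have [f0'|fn0] := eqVneq f 0; first by rewrite f0' t0 ?mulr0.
have f00 : f0 != 0 by apply: contra_eq_neq f0x0 => ->; rewrite eq_sym oner_neq0.
have [y [fy f0y]] := both_dual_neq0 fn0 f00.
have te : t x0 f0 = xi by rewrite /t; case: uh0 => -> ->.
rewrite (t1 x y f fy) (t2 y f f0 f0y) (t1 y x0 f0) ?f0x0 ?oner_eq0// te.
by field; rewrite fy f0y.
Qed.

(** The trace identity carries the factor (f x)^(n-1), which cancels when f x <> 0. Otherwise x is
    the difference of x + y and y, where f y = 1, and additivity applies. *)
Lemma pairing_op a x f : A a -> h x f (phi a (u x f)) = xi ^+ 2 * f (a x).
Proof.
move=> Aa; have la := A_linear hA (phiA Aa).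
have nz y : f y != 0 -> h y f (phi a (u y f)) = xi ^+ 2 * f (a y).
  move=> fy; apply: xi_cancel.
  have := phi_tr' Aa (phi_uh y f); rewrite pairing_id exprMn mulrAC.
  have fyn : f y ^+ n.-1 != 0 by rewrite expf_neq0.
  by rewrite [f y ^+ _ * _]mulrC => /(mulIf fyn).
have [fx|] := eqVneq (f x) 0; last exact: nz.
have [f0'|/dual_neq0[y fy]] := eqVneq f 0.
  by have := Zf la x 0 f; rewrite scale0r -f0' !mul0r f0' mulr0.
have fy0 : f y != 0 by rewrite fy oner_eq0.
have fxy : f (x + y) != 0 by rewrite dual_D fx add0r.
have := lx la f 1 x y; rewrite scale1r mul1r (nz _ fy0) (nz _ fxy).
rewrite (lop_D _ _ (A_linear hA Aa)) dual_D mulrDr => /addIr; exact: esym.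
Qed.

End Pairing.

Lemma phi_direct (S : E -> E) (T : dual E -> dual E) :
  (forall c x y, S (c *: x + y) = c *: S x + S y) ->
  (forall c f g, T (c *: f + g) = c *: T f + T g) ->
  (forall x f, phi (tens x f) = tens (S x) (T f)) -> S x0 = u0 -> T f0 = h0 ->
  exists S Sinv : E -> E, invertible_op S Sinv /\
    forall a, A a -> phi a = (fun x => xi *: S (a (Sinv x))).
Proof.
move=> Sl Tl phiE Sx0 Tf0.
have lx b : is_linear_op b -> forall f c x y,
    T f (b (S (c *: x + y))) = c * T f (b (S x)) + T f (b (S y)).
  by move=> lb f c x y; rewrite Sl (lop_D _ _ lb) (lop_Z _ _ lb) dual_D dual_Z.
have lf b : is_linear_op b -> forall x c f g,
    T (c *: f + g) (b (S x)) = c * T f (b (S x)) + T g (b (S x)).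
  by move=> lb x c f g; rewrite Tl.
have F1 x f := pairing_id phiE (conj Sx0 Tf0) lx lf x f.
have F2 a x f Aa := pairing_op phiE (conj Sx0 Tf0) lx lf x f (a := a) Aa.
have xi0 := xi_neq0.
(* If all T f kill v, then a preimage b of v (x) k has f (b x) = 0 throughout; so b = 0 and v (x) k
   = phi 0 = 0. *)
have Tsep v : (forall f, T f v = 0) -> v = 0.
  move=> Tv; apply/eqP/negPn/negP => v0; have [k kv] := dual_sep v0.
  have [b Ab bE] := phi_onto_tens v k.
  have b0 : b = 0.
    apply/funext => x; apply: dual_eq0 => f; have := F2 b x f Ab.
    rewrite bE /tens dual_Z Tv mulr0 => /esym/eqP.
    by rewrite mulf_eq0 expf_eq0 (negPf xi0) andbF => /eqP.
  have : tens v k v = 0 by rewrite -bE b0 phi_0.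
  by rewrite /tens kv scale1r => /eqP; apply/negP.
have Tinj v w : (forall f, T f v = T f w) -> v = w.
  by move=> e; apply/subr0_eq/Tsep => f; rewrite dual_B e subrr.
have [k0 k0u] := dual_sep u00.
have Ssurj v : exists x, S x = v.
  have [b Ab bE] := phi_onto_tens v k0.
  (* As phi b = v (x) k0 maps u0 = S x0 to v, [F2] gives T f v = xi^2 f (b x0), which is T f (S (xi
     b x0)) by [F1]. *)
  exists (xi *: b x0); apply: Tinj => f; rewrite F1 dual_Z mulrA -expr2.
  by rewrite -(F2 b x0 f Ab) bE /tens Sx0 k0u scale1r.
have [Si SiP] := choice Ssurj.
have Sinj x y : S x = S y -> x = y.
  move=> e; apply: dual_inj => f; apply: (mulfI xi0).
  by rewrite -!F1 e.
have SK : cancel S Si by move=> x; apply: Sinj.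
have lSi : is_linear_op Si.
  by move=> c x y; apply: Sinj; rewrite Sl !SiP.
exists S, Si; split; last first.
  move=> a Aa; apply/funext => v; rewrite -{1}(SiP v).
  apply: Tinj => f; rewrite (F2 a (Si v) f Aa) dual_Z F1 expr2 mulrA.
  by [].
split=> //.
(* With h0 v = 1 and phi b = v (x) k, evaluating h0 (phi b (S x)) gives k (S x) = xi^2 f0 (b x),
   which is bounded in x. *)
- apply: weakly_bounded => // k; have [v hv] := dual_neq0 h00.
  have [b Ab bE] := phi_onto_tens v k.
  have -> : k \o S = (xi ^+ 2 *: dual_comp f0 (A_bounded hA Ab) : dual E).
    apply/funext => x; rewrite dualE_Z /= -(F2 b x f0 Ab) bE /tens Tf0 dual_Z hv mulr1.
    by [].
  exact: dual_valE.
- apply: weakly_bounded => // k.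
  have -> : k \o Si = (xi^-1 *: T k : dual E).
    by apply/funext => v; rewrite dualE_Z /= -{2}(SiP v) F1 mulKf.
  exact: dual_valE.
Qed.

Lemma phi_dual (S : E -> dual E) (T : dual E -> E) :
  (forall c x y, S (c *: x + y) = c *: S x + S y) ->
  (forall c f g, T (c *: f + g) = c *: T f + T g) ->
  (forall x f, phi (tens x f) = tens (T f) (S x)) -> S x0 = h0 -> T f0 = u0 ->
  exists (S : (E -> R[i]) -> E) (Sinv : E -> (E -> R[i])), invertible_dual_op S Sinv /\
    forall a, A a -> phi a = (fun x => xi *: S (fun y => Sinv x (a y))).
Proof.
move=> Sl Tl phiE Sx0 Tf0.
have lx b : is_linear_op b -> forall f c x y,
    S (c *: x + y) (b (T f)) = c * S x (b (T f)) + S y (b (T f)).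
  by move=> lb f c x y; rewrite Sl.
have lf b : is_linear_op b -> forall x c f g,
    S x (b (T (c *: f + g))) = c * S x (b (T f)) + S x (b (T g)).
  by move=> lb x c f g; rewrite Tl (lop_D _ _ lb) (lop_Z _ _ lb) dual_D dual_Z.
have F1 x f := pairing_id phiE (conj Tf0 Sx0) lx lf x f.
have F2 a x f Aa := pairing_op phiE (conj Tf0 Sx0) lx lf x f (a := a) Aa.
have xi0 := xi_neq0.
have Ssep v : (forall x, S x v = 0) -> v = 0.
  move=> Sv; apply/eqP/negPn/negP => v0; have [k kv] := dual_sep v0.
  have [b Ab bE] := phi_onto_tens v k.
  have b0 : b = 0.
    apply/funext => x; apply: dual_eq0 => f; have := F2 b x f Ab.
    rewrite bE /tens dual_Z Sv mulr0 => /esym/eqP.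
    by rewrite mulf_eq0 expf_eq0 (negPf xi0) andbF => /eqP.
  have : tens v k v = 0 by rewrite -bE b0 phi_0.
  by rewrite /tens kv scale1r => /eqP; apply/negP.
have Sinj v w : (forall x, S x v = S x w) -> v = w.
  by move=> e; apply/subr0_eq/Ssep => x; rewrite dual_B e subrr.
have [k0 k0u] := dual_sep u00.
have Tsurj v : exists f, T f = v.
  have [b Ab bE] := phi_onto_tens v k0.
  exists (xi *: dual_comp f0 (A_bounded hA Ab)); apply: Sinj => x.
  rewrite F1 dualE_Z /= mulrA -expr2.
  by rewrite -(F2 b x f0 Ab) bE /tens Tf0 k0u scale1r.
have [Ti TiP] := choice Tsurj.
have Tinj f g : T f = T g -> f = g.
  move=> e; apply: dual_eq => x; apply: (mulfI xi0).
  by rewrite -!F1 e.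
have TK : cancel T Ti by move=> f; apply: Tinj.
have SE x v : S x v = xi * Ti v x by rewrite -{1}(TiP v) F1.
have TZ (c : R[i]) f : T (c *: f) = c *: T f.
  have z : T 0 = 0 by apply: (addrI (T 0)); have := Tl 1 0 0; rewrite !scale1r !addr0 => <-.
  by have := Tl c f 0; rewrite z !addr0.
have TD f g : T (f + g) = T f + T g by have := Tl 1 f g; rewrite !scale1r.
(* The operator has to be defined on all functions E -> R[i]; off the dual it takes the default
   value 0. *)
pose S' (f : E -> R[i]) : E :=
  if pselect (dual_elem f) is left hf then T (to_dual hf) else 0.
have S'E f : S' f = T f.
  rewrite /S'; case: pselect => [hf|/(_ (dual_valE f))//].
  by congr T; exact: dual_eq.
have S'E' (f : E -> R[i]) (hf : dual_elem f) : S' f = T (to_dual hf) by rewrite -S'E.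
exists S', (fun x => Ti x); split; last first.
  move=> a Aa; apply/funext => v.
  have -> : (fun y => Ti v (a y)) = dual_comp (Ti v) (A_bounded hA Aa) by [].
  rewrite S'E; apply: Sinj => x.
  by rewrite -{1}(TiP v) (F2 a x (Ti v) Aa) dual_Z F1 expr2 mulrA.
split.
- by move=> x; exact: dual_valE.
- split=> [f hf|x]; last by rewrite S'E TiP.
  by rewrite (S'E' _ hf) TK.
- move=> c f g hf hg; rewrite (S'E' _ hf) (S'E' _ hg).
  have -> : (fun y => c * f y + g y) = (c *: to_dual hf + to_dual hg : dual E) by [].
  by rewrite S'E Tl.
- have [] := @uniform_boundedness R (dual E) (@opnorm R E)
    {k : dual E | forall y, nr (k y) <= nr y} (fun j f => nr (sval j (T f))).
  + exact: opnorm_ge0.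
  + exact: opnormN.
  + exact: opnormZ.
  + exact: opnorm_geometric_complete.
  + by move=> k f g; rewrite TD dual_D nrD.
  + by move=> k f; rewrite -scaleN1r TZ dual_Z mulN1r nrN.
  + by move=> k r f r0; rewrite TZ dual_Z nrM nr_real// ltW.
  (* Here the evaluation is at x0: h0 (phi b (T f)) gives k (T f) = xi^2 f (b x0), bounded in f by
     [opnorm f]. *)
  + move=> [k k1] /=; have [v hv] := dual_neq0 h00.
    have [b Ab bE] := phi_onto_tens v k.
    exists (nr (xi ^+ 2) * nr (b x0)) => f.
    have -> : k (T f) = xi ^+ 2 * f (b x0).
      by rewrite -(F2 b x0 f Ab) bE /tens Sx0 dual_Z hv mulr1.
    rewrite nrM -mulrA ler_wpM2l ?nr_ge0// mulrC; exact: opnormP.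
  + by move=> f; exists (nr (T f)) => -[k k1] /=; exact: k1.
  move=> M MT; exists `|M| => f c hf c0 fc.
  rewrite (S'E' _ hf) nrE lecR.
  have [k [k1 kT]] := norming_dual (T (to_dual hf)).
  rewrite -kT; apply: le_trans (MT (exist _ k k1) (to_dual hf)) _.
  apply: le_trans (ler_wpM2r (opnorm_ge0 _) (ler_norm M)) _.
  rewrite ler_wpM2l//; apply: opnorm_le => // y.
  by have := fc y; rewrite !nrE -rmorphM /= lecR.
- have Si0 : nr xi != 0 by rewrite nr_eq0.
  (* The functional S x is bounded in v, and S x v = xi (Ti v) x is bounded in x; normalizing by |x|
     turns these separate bounds into a joint one. At x = 0 the factor is 0 by the convention for
     inverses. *)
  have [] := @uniform_boundedness R E (@nr R E) E (fun x v => (nr x)^-1 * nr (S x v)).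
  + exact: nr_ge0.
  + exact: nrN.
  + by move=> r x r0; rewrite nrZ nr_real// ltW.
  + exact: nr_geometric_complete.
  + by move=> x v w; rewrite dual_D -mulrDr ler_wpM2l ?invr_ge0 ?nr_ge0// nrD.
  + by move=> x v; rewrite -scaleN1r dual_Z mulN1r nrN.
  + by move=> x r v r0; rewrite dual_Z nrM (nr_real (ltW r0)) mulrCA.
  + move=> x; exists ((nr x)^-1 * opnorm (S x)) => v.
    by rewrite -mulrA ler_wpM2l ?invr_ge0 ?nr_ge0// opnormP.
  + move=> v; exists (nr xi * opnorm (Ti v)) => x.
    rewrite SE nrM mulrCA ler_wpM2l ?nr_ge0//.
    have [x00|x00] := eqVneq (nr x) 0; first by rewrite x00 invr0 mul0r opnorm_ge0.
    have nx : 0 < nr x by rewrite lt_def x00 nr_ge0.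
    by rewrite ler_pdivrMl// mulrC opnormP.
  move=> M MS; exists ((nr xi)^-1 * M) => x y.
  rewrite !nrE -!rmorphM lecR /=.
  have := MS y x; rewrite SE nrM.
  have [->|y0] := eqVneq y 0; first by rewrite dual_0 !nr0 !mulr0.
  have ny : 0 < nr y by rewrite lt_def nr_eq0 y0 nr_ge0.
  have nx : 0 < nr xi by rewrite lt_def Si0 nr_ge0.
  rewrite ler_pdivrMl// -ler_pdivlMl// => /le_trans; apply.
  by rewrite le_eqVlt; apply/orP; left; apply/eqP; ring.
Qed.

Lemma phi_form : exists xi : R[i], xi ^+ n.+1 = 1 /\
  ( (exists S Sinv : E -> E, invertible_op S Sinv /\
       forall a, A a -> phi a = (fun x => xi *: S (a (Sinv x))))
    \/
    (exists (S : (E -> R[i]) -> E) (Sinv : E -> (E -> R[i])), invertible_dual_op S Sinv /\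
       forall a, A a -> phi a = (fun x => xi *: S (fun y => Sinv x (a y)))) ).
Proof.
have tt := tens_tensor_like E.
have x00 : x0 != 0 by apply: contra_eq_neq f0x0 => ->; rewrite dual_0 eq_sym oner_neq0.
have f00 : f0 != 0 by apply: contra_eq_neq f0x0 => ->; rewrite eq_sym oner_neq0.
exists xi; split; first exact: xi_root.
have [[P Q]|[P Q]] := phi_sides.
- left; have [S [T [Sl Tl e Sx0 Tf0]]] := rank1_bilinear tt phi_Dl phi_Dr phi_Zl phi_Zr
    phi_rank1 phi_eq0 x00 f00 phi_e P Q.
  exact: (phi_direct Sl Tl e Sx0 Tf0).
- right.
  have rk x f : exists h u, phi (tens x f) = tens u h.
    by have [u [h e]] := phi_rank1 x f; exists h, u.
  have [S [T [Sl Tl e Sx0 Tf0]]] := rank1_bilinear (tensor_like_swap tt) phi_Dl phi_Dr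
    phi_Zl phi_Zr rk phi_eq0 x00 f00 phi_e P Q.
  exact: (phi_dual Sl Tl e Sx0 Tf0).
Qed.

End Base.
End Structure.

Theorem theorem2p4 (R : realType) (E : completeNormedModType R[i])
  (A : set (E -> E)) (k : nat) (idx : seq 'I_k)
  (phi : (E -> E) -> (E -> E)) :
  standard_operator_algebra A ->
  (2 <= k)%N ->
  (forall i : 'I_k, i \in idx) ->
  (exists p : 'I_k, count_mem p idx = 1%N) ->
  (forall a, A a -> A (phi a)) ->
  ( ( (forall T, bounded_op T -> rank_le T 2 -> exists2 a, A a & phi a = T) /\
      (forall a : 'I_k -> E -> E, (forall j, A (a j)) -> (exists j, rank_le (a j) 1) ->
         exists th, algebra_automorphism A th /\
           gen_prod idx (fun j => phi (a j)) = th (gen_prod idx a)) )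
    \/
    ( (forall T, bounded_op T -> rank_le T 3 -> exists2 a, A a & phi a = T) /\
      (forall a : 'I_k -> E -> E, (forall j, A (a j)) -> (exists j, rank_le (a j) 1) ->
         exists th, jordan_automorphism A th /\
           gen_jordan idx (fun j => phi (a j)) = th (gen_jordan idx a)) ) ) ->
  exists xi : R[i], xi ^+ size idx = 1 /\
    ( (exists S Sinv : E -> E, invertible_op S Sinv /\
         forall a, A a -> phi a = (fun x => xi *: S (a (Sinv x))))
      \/
      (exists (S : (E -> R[i]) -> E) (Sinv : E -> (E -> R[i])), invertible_dual_op S Sinv /\
         forall a, A a -> phi a = (fun x => xi *: S (fun y => Sinv x (a y)))) ).
Proof.
move=> hA k2 idx_all once phiA hyp.
have [n [n0 -> tp surj]] := gen_trace_preserving hA phiA k2 idx_all once hyp.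
(* The zero space has no rank-one idempotent to start from; there all maps agree, so xi = 1 and S =
   id work. *)
have [[x x0]|/forallNP zero] := pselect (exists x : E, x != 0); last first.
  have E0 (x y : E) : x = y.
    by have /negP/negPn/eqP -> := zero x; have /negP/negPn/eqP -> := zero y.
  have bid : bounded_op (fun x : E => x) by split=> //; exists 1 => x; rewrite mul1r.
  exists 1; rewrite expr1n; split=> //; left; exists (fun x => x), (fun x => x).
  by split=> // a Aa; apply/funext => x; exact: E0.
have [f fx] := dual_sep x0.
have [u [h e]] : exists u h, phi (tens x f) = tens u h.
  by case: tp => H _ _; apply: H; [exact: A_tens|exists x, f].
exact: (phi_form hA phiA n0 tp surj fx e).
Qed.
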